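(* Consider the rate-unconstrained multi-agent contextual bandit setting described in the context, in which the decision-maker runs Thompson Sampling (one independent Bayesian multi-armed bandit per context), samples the arms of all $N$ agents in a round from the current Thompson Sampling policy, and updates the posteriors only at the end of each round. Let $T = J N$ be the total number of arm pulls (virtual rounds). Then the finite-time Bayesian system regret of Thompson Sampling satisfies $$\mathrm{BR}(\pi^{TS}, T) \leq 2SKN + 4\sqrt{(2 + 6\log T)\, S K N T},$$ and the asymptotic regret satisfies $\mathrm{BR}(\pi^{TS}, T) \in \mathcal{O}\big(\sqrt{K S T \log T}\big)$.
   Context: Setting: $\mathcal{S}$ is a finite set of $S=|\mathcal{S}|$ contexts with distribution $P_S$, $P_S(s)>0$ for all $s$; $\mathcal{A}=\{1,\dots,K\}$ is the set of arms. For each pair $(s,a)$, pulling arm $a$ in context $s$ yields a random reward $R(s,a)\in[0,1]$ drawn from an unknown stationary distribution $P_R(\cdot\mid s,a)$ belonging to an exponential family $P_R(r\mid\theta)=b(r)\exp(\eta(\theta)T(r)-A(\theta))$ with $\theta=(s,a)$, known $b,T,A$ and $A$ twice differentiable; $\mu(s,a)=\mathbb{E}[R(s,a)]$ and $a^*(s)\in\arg\max_a \mu(s,a)$. There are $N$ agents solving the same problem instance; in each round $j=1,\dots,J$ each agent $n$ receives an independent context $s_{j,n}\sim P_S$, observed by a central decision-maker, which chooses an arm $A_{j,n}$ for every agent; the policy can only be updated at the end of each round after all $N$ rewards are observed. Thompson Sampling: for each $(s,a)$ the decision-maker maintains a posterior $p_j^{s,a}$ on $\mu(s,a)$; for an agent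 with context $s$ it samples $\hat\mu(s,a)\sim p_j^{s,a}$ independently for all $a$ and plays $\arg\max_a\hat\mu(s,a)$; posteriors are updated by Bayes' rule at the end of each round. The Bayesian system regret is $\mathrm{BR}=\mathbb{E}\big[\sum_{j=1}^J\sum_{n=1}^N \mu(s_{j,n},a^*(s_{j,n}))-\mu(s_{j,n},A_{j,n})\big]$, with expectation over contexts, arm choices and the prior over problem instances; written as a function of $T=JN$. *)

(* Defs.v *)
From HB Require Import structures.
From mathcomp Require Import all_boot all_order all_algebra.
From mathcomp Require Import all_classical all_reals all_analysis.
Set Implicit Arguments. Unset Strict Implicit. Unset Printing Implicit Defensive.
Import Order.TTheory GRing.Theory Num.Theory.
Import numFieldNormedType.Exports.
Local Open Scope classical_set_scope.
Local Open Scope ring_scope.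

Record ts_model (R : realType) (S : finType) (K : nat) := TSModel {
  PS : S -> R;
  nu : {measure set R -> \bar R};
  bf : R -> R;
  Tf : R -> R;
  etaf : R -> R;
  Af : R -> R;
  Theta : set R;
  prior : S -> 'I_K -> probability R R
}.

Section TS.
Variables (R : realType) (S : finType) (K : nat) (M : ts_model R S K).

(* reward density P_R(r | theta) w.r.t. nu, on [0,1] *)
Definition dens (th r : R) : R :=
  bf M r * expR (etaf M th * Tf M r - Af M th).

Definition mean_of (th : R) : R :=
  fine (\int[nu M]_(r in `[0%R, 1%R]) (r * dens th r)%:E)%E.

Definition instance := S -> 'I_K -> R.

Definition mustar (th : instance) (s : S) : R :=
  \big[Num.max/0]_(a < K) mean_of (th s a).

Definition history := seq (S * 'I_K * R).

(* likelihood of parameter value x for pair (s,a) given history h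
   (b(r) factors cancel in Bayes' rule) *)
Definition lik (h : history) (s : S) (a : 'I_K) (x : R) : R :=
  \prod_(o <- h | (o.1.1 == s) && (o.1.2 == a))
     expR (etaf M x * Tf M o.2 - Af M x).

Definition post_norm (h : history) (s : S) (a : 'I_K) : R :=
  fine (\int[prior M s a]_x (lik h s a x)%:E)%E.

Definition post (h : history) (s : S) (a : 'I_K) (B : set R) : R :=
  fine (\int[prior M s a]_(x in B) (lik h s a x)%:E)%E / post_norm h s a.

(* Thompson Sampling probability of playing arm a in context s given history
   h: the posterior probability that a is the argmax of independent posterior
   samples of mu(s, .) (ties broken towards the smallest index). *)
Definition ts_prob (h : history) (s : S) (a : 'I_K) : R :=
  fine (\int[prior M s a]_x
     (lik h s a x *
      \prod_(a' < K | a' != a)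
         post h s a' [set y | if (a' < a)%N then mean_of y < mean_of x
                              else mean_of y <= mean_of x])%:E)%E
  / post_norm h s a.

Fixpoint rw_int (th : instance) (ps : seq (S * 'I_K)) (G : seq R -> R) : R :=
  match ps with
  | [::] => G [::]
  | p :: ps' => fine (\int[nu M]_(r in `[0%R, 1%R])
       (dens (th p.1 p.2) r * rw_int th ps' (fun rs => G (r :: rs)))%:E)%E
  end.

Variable N : nat.

Definition pulls (c : {ffun 'I_N -> S}) (acts : {ffun 'I_N -> 'I_K}) :=
  [seq (c n, acts n) | n <- enum 'I_N].

Fixpoint ts_regret (th : instance) (j : nat) (h : history) : R :=
  match j with
  | 0 => 0
  | j'.+1 =>
    \sum_(c : {ffun 'I_N -> S}) (\prod_(n < N) PS M (c n)) *
    \sum_(acts : {ffun 'I_N -> 'I_K}) (\prod_(n < N) ts_prob h (c n) (acts n)) *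
      ((\sum_(n < N) (mustar th (c n) - mean_of (th (c n) (acts n))))
       + rw_int th (pulls c acts)
           (fun rs => ts_regret th j' (h ++ zip (pulls c acts) rs)))
  end.

Definition upd (th : instance) (p : S * 'I_K) (x : R) : instance :=
  fun s a => if (s == p.1) && (a == p.2) then x else th s a.

Fixpoint prior_int (ps : seq (S * 'I_K)) (F : instance -> R) (th : instance) : R :=
  match ps with
  | [::] => F th
  | p :: ps' => fine (\int[prior M p.1 p.2]_x (prior_int ps' F (upd th p x))%:E)%E
  end.

Definition BR (J : nat) : R :=
  prior_int (enum [set: S * 'I_K]) (fun th => ts_regret th J [::])
            (fun _ _ => 0).

End TS.

(* Main.v *)
Require Import Defs.
From HB Require Import structures.
From mathcomp Require Import all_boot all_order all_algebra.
From mathcomp Require Import all_classical all_reals all_analysis.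
From mathcomp Require Import measurable_realfun ring lra.
Import Order.TTheory GRing.Theory Num.Theory.
Import numFieldNormedType.Exports.
Local Open Scope classical_set_scope.
Local Open Scope ring_scope.

(** The bound follows from an entropy argument rather than from confidence
    bounds.  Let [p] be the posterior of the optimal arm of a context, which is
    also the law of the arm that Thompson Sampling plays there.  The regret of
    one pull is [\sum_a p a * (E[mu_a | A* = a] - E[mu_a])].  By the Gibbs variational
    inequality, [p a * (E[mu_a | A* = a] - E[mu_a])] is at most
    [lam + (2 * p a / lam) * D_a], where [D_a] is the expected decrease, over
    the round, of the term [- p a * ln (p a)] of the posterior entropy when arm
    [a] is pulled.  Each of the [N] pulls of a round is charged to the same
    entropy decrease, and the entropies telescope from at most [ln K] per
    context, so that
    [BR <= T * K * lam + (2 * N / lam) * S * ln K].  Optimising [lam] gives the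
    claim when [K <= T]; when [K > T] the trivial bound [BR <= T] suffices.

    Posteriors are kept unnormalised (a likelihood integrated against the
    prior), so null sets of histories need no separate treatment: where the
    normalising constant [Zps] is infinite the inequalities are trivial in the
    extended reals. *)

(** The variational inequality enters in the linearised form [ln y <= y - 1] with free constants
    [eps] and [t]: an inequality between nonnegative linear expressions can be integrated over all
    rewards of a round by Tonelli alone, and [eps], [t] are fixed only afterwards, as functions of
    the history. The choice [t = lam / (2 * p a)] gives the entropy decrease the coefficient
    [2 * p a / lam], and this [p a] is the probability that the agent plays [a]; a bound that speaks
    of a round in which [a] is pulled can therefore be averaged over the arms actually drawn. The
    agents of a round act on one posterior, so the decrease is not apportioned among them; charging
    it [N] times produces the [N] under the square root.

    The obstacle is the form of the definitions: they apply [fine] at every integral, and the data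
    of the model are measurable only on [Theta] and on [[0, 1]]. Uniform bounds are carried through
    the recursions to show that [fine] loses nothing, and the model is replaced by one with
    everywhere measurable data and the same regret. *)

Set Implicit Arguments. Unset Strict Implicit. Unset Printing Implicit Defensive.

(** * Iterated integrals over coordinates *)

Section Coordinates.
Variables (R : realType) (I : choiceType).

Definition eval_sets : set (set (I -> R)) :=
  [set A | exists i, exists2 B, measurable B & A = (fun w => w i) @^-1` B].

(* Only finitely many coordinates are ever integrated, one at a time, so no
   product measure on this space is needed. *)
Definition Coord : Type := g_sigma_algebraType eval_sets.
HB.instance Definition _ := Measurable.on Coord.

Definition setc (w : Coord) (i : I) (x : R) : Coord :=
  fun k => if k == i then x else w k.

Lemma setc_eq w i x : setc w i x i = x.
Proof. by rewrite /setc eqxx. Qed.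

Lemma setc_neq w i x k : k != i -> setc w i x k = w k.
Proof. by rewrite /setc => /negPf ->. Qed.

Lemma setcC w i j x y : i != j ->
  setc (setc w i x) j y = setc (setc w j y) i x.
Proof.
move=> ij; apply/funext => k; rewrite /setc.
by case: (eqVneq k j) => // ->; rewrite eq_sym (negPf ij).
Qed.

Lemma measurable_eval i : measurable_fun setT (fun w : Coord => w i).
Proof.
move=> _ B mB; rewrite setTI; apply: sub_sigma_algebra.
by exists i; exists B.
Qed.

Lemma measurable_coord d (T : measurableType d) (f : T -> Coord) :
  (forall i, measurable_fun setT (fun t => f t i)) -> measurable_fun setT f.
Proof.
move=> mf; apply: (@measurability _ _ T Coord setT f eval_sets) => // _ [_ [i [B mB ->]] <-].
by have := mf i measurableT B mB.
Qed.

Lemma measurable_setc i :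
  measurable_fun setT (fun p : Coord * R => setc p.1 i p.2).
Proof.
apply: measurable_coord => k; rewrite /setc; case: eqP => _.
  exact: measurable_snd.
exact: (measurableT_comp (measurable_eval k) measurable_fst).
Qed.

End Coordinates.

Section IteratedIntegrals.
Local Open Scope ereal_scope.
Variables (R : realType) (I : choiceType).
Variables (m : I -> {sigma_finite_measure set R -> \bar R}) (wt : I -> R -> R).
Hypothesis wt_meas : forall i, measurable_fun setT (wt i).
Hypothesis wt_ge0 : forall i x, (0 <= wt i x)%R.
Notation Om := (Coord R I).
Implicit Types (F G : Om -> \bar R) (l : seq I).

Definition nnmeas F := measurable_fun setT F /\ forall w, 0 <= F w.

(** The result is again a function of the whole point, constant in coordinate [i], so that such
    integrals compose by [foldr]. *)
Definition int1 (i : I) F : Om -> \bar R :=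
  fun w => \int[m i]_x ((wt i x)%:E * F (setc w i x)).

Definition ints l F := foldr int1 F l.

Let wt2 i F := fun p : Om * R => (wt i p.2)%:E * F (setc p.1 i p.2).

Lemma nnmeas_wt2 i F : nnmeas F ->
  measurable_fun setT (wt2 i F) /\ forall p, 0 <= wt2 i F p.
Proof.
move=> [mF F0]; split; last by move=> p; rewrite mule_ge0// lee_fin.
apply: emeasurable_funM; last exact: measurableT_comp mF (measurable_setc i).
by apply/measurable_EFinP; exact: measurableT_comp (wt_meas i) measurable_snd.
Qed.

Lemma nnmeas_integrand i F w : nnmeas F ->
  measurable_fun setT (fun x => (wt i x)%:E * F (setc w i x)) /\
  forall x, 0 <= (wt i x)%:E * F (setc w i x).
Proof.
move=> /(nnmeas_wt2 i)[h1 h2]; split; last by move=> x; exact: (h2 (w, x)).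
exact: (measurable_fun_pair2 w h1).
Qed.

Lemma nnmeas_int1 i F : nnmeas F -> nnmeas (int1 i F).
Proof.
move=> nF; have [h1 h2] := nnmeas_wt2 i nF; split.
  exact: (measurable_fun_fubini_tonelli_F (m2 := m i) (wt2 i F) h1).
by move=> w; apply: integral_ge0 => x _; exact: (h2 (w, x)).
Qed.

Lemma nnmeas_ints l F : nnmeas F -> nnmeas (ints l F).
Proof. by move=> nF; elim: l => //= i l; exact: nnmeas_int1. Qed.

Lemma nnmeasD F G : nnmeas F -> nnmeas G -> nnmeas (fun w => F w + G w).
Proof.
move=> [mF F0] [mG G0]; split; last by move=> w; exact: adde_ge0.
exact: emeasurable_funD.
Qed.

Lemma nnmeasM F G : nnmeas F -> nnmeas G -> nnmeas (fun w => F w * G w).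
Proof.
move=> [mF F0] [mG G0]; split; last by move=> w; exact: mule_ge0.
exact: emeasurable_funM.
Qed.

Lemma nnmeas_cst (c : \bar R) : 0 <= c -> nnmeas (fun=> c).
Proof. by move=> c0; split. Qed.

Lemma nnmeas_sum J (s : seq J) (F : J -> Om -> \bar R) :
  (forall j, nnmeas (F j)) -> nnmeas (fun w => \sum_(j <- s) F j w).
Proof.
move=> nF; split; first by apply: emeasurable_sum => j; have [] := nF j.
by move=> w; apply: sume_ge0 => j _; have [_] := nF j.
Qed.

Lemma nnmeas_prod (J : eqType) (s : seq J) (F : J -> Om -> \bar R) :
  (forall j, j \in s -> nnmeas (F j)) -> nnmeas (fun w => \prod_(j <- s) F j w).
Proof.
elim: s => [|j s ih] nF.
  under eq_fun do rewrite big_nil; exact: nnmeas_cst.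
under eq_fun do rewrite big_cons; apply: nnmeasM; first by apply: nF; rewrite mem_head.
by apply: ih => k ks; apply: nF; rewrite inE ks orbT.
Qed.

Lemma nnmeas_EFin (f : Om -> R) :
  measurable_fun setT f -> (forall w, (0 <= f w)%R) -> nnmeas (EFin \o f).
Proof. by move=> mf f0; split => [|w]; [exact/measurable_EFinP|rewrite lee_fin]. Qed.

Lemma ints_ge0 l F w : nnmeas F -> 0 <= ints l F w.
Proof. by move=> /(nnmeas_ints l)[]. Qed.

Lemma intsD l F G w : nnmeas F -> nnmeas G ->
  ints l (fun w => F w + G w) w = ints l F w + ints l G w.
Proof.
move=> nF nG; elim: l w => //= i l ih w.
rewrite /int1 -ge0_integralD//; last 4 first.
- by move=> x _; apply: (nnmeas_integrand i w (nnmeas_ints l nF)).2.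
- exact: (nnmeas_integrand i w (nnmeas_ints l nF)).1.
- by move=> x _; apply: (nnmeas_integrand i w (nnmeas_ints l nG)).2.
- exact: (nnmeas_integrand i w (nnmeas_ints l nG)).1.
by apply: eq_integral => x _; rewrite ih ge0_muleDr//; exact: ints_ge0.
Qed.

Lemma ints0 l w : ints l (fun=> 0) w = 0.
Proof.
elim: l w => //= i l ih w; rewrite /int1.
by under eq_integral do rewrite ih mule0; exact: integral0.
Qed.

Lemma ints_sum l J (s : seq J) (F : J -> Om -> \bar R) w :
  (forall j, nnmeas (F j)) ->
  ints l (fun w => \sum_(j <- s) F j w) w = \sum_(j <- s) ints l (F j) w.
Proof.
move=> nF; elim: s => [|j s ih].
  rewrite big_nil -[RHS](ints0 l w); congr (ints l _ w).
  by apply/funext => v; rewrite big_nil.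
rewrite big_cons -ih -intsD//; last exact: nnmeas_sum.
by congr (ints l _ w); apply/funext => v; rewrite big_cons.
Qed.

Lemma intsZ l F (c : \bar R) w : nnmeas F -> 0 <= c ->
  ints l (fun w => c * F w) w = c * ints l F w.
Proof.
move=> nF c0; elim: l w => //= i l ih w.
rewrite /int1 -ge0_integralZl//; last 2 first.
- exact: (nnmeas_integrand i w (nnmeas_ints l nF)).1.
- by move=> x _; apply: (nnmeas_integrand i w (nnmeas_ints l nF)).2.
by apply: eq_integral => x _; rewrite ih muleCA.
Qed.

(** These are the points at which [ints l F w] may evaluate [F]. *)
Definition agree_off l (v w : Om) := forall i, i \notin l -> v i = w i.

Lemma agree_off_setc i l v w x :
  agree_off l v (setc w i x) -> agree_off (i :: l) v w.
Proof. by move=> h k; rewrite inE negb_or => /andP[ki /h ->]; exact: setc_neq. Qed.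

Lemma eq_ints l F G w : (forall v, agree_off l v w -> F v = G v) ->
  ints l F w = ints l G w.
Proof.
elim: l w => /= [w|i l ih w] h; first exact: h.
apply: eq_integral => x _; congr (_ * _); apply: ih => v /agree_off_setc.
exact: h.
Qed.

(** The comparison is asked only where no weight vanishes; for reward coordinates this confines the
    rewards to [[0, 1]]. Since [l] has no repetition, an inner integral never overwrites the
    coordinate whose weight was tested. *)
Lemma le_ints l F G w : uniq l -> nnmeas F -> nnmeas G ->
  (forall v, agree_off l v w -> (forall i, i \in l -> wt i (v i) != 0%R) ->
     F v <= G v) ->
  ints l F w <= ints l G w.
Proof.
move=> + nF nG; elim: l w => /= [w _ h|i l ih w /andP[il ul] h]; first exact: h.
apply: ge0_le_integral => //.
- by move=> x _; apply: (nnmeas_integrand i w (nnmeas_ints l nF)).2.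
- exact: (nnmeas_integrand i w (nnmeas_ints l nF)).1.
- exact: (nnmeas_integrand i w (nnmeas_ints l nG)).1.
move=> x _; have [->|w0] := eqVneq (wt i x) 0%R; first by rewrite !mul0e.
apply: lee_wpmul2l; first by rewrite lee_fin.
apply: ih => // v hv hl; apply: h; first exact: agree_off_setc hv.
move=> k; rewrite inE => /predU1P[->|]; last exact: hl.
by rewrite hv// setc_eq.
Qed.

Lemma intsZ_indep l F (C : Om -> \bar R) w : nnmeas F ->
  (forall v, 0 <= C v) -> (forall v, agree_off l v w -> C v = C w) ->
  ints l (fun v => C v * F v) w = C w * ints l F w.
Proof.
move=> nF C0 hC; rewrite -intsZ//; apply: eq_ints => v /hC -> //.
Qed.

(** Tonelli's theorem for the restriction of [F] to the plane of the coordinates [i] and [j] through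
    [w]. *)
Lemma int1C i j F : i != j -> nnmeas F ->
  int1 i (int1 j F) = int1 j (int1 i F).
Proof.
move=> ij nF; apply/funext => w; rewrite /int1.
pose f (p : R * R) := (wt i p.1)%:E * ((wt j p.2)%:E * F (setc (setc w i p.1) j p.2)).
have mf : measurable_fun setT f.
  apply: emeasurable_funM.
    by apply/measurable_EFinP; exact: measurableT_comp (wt_meas i) measurable_fst.
  apply: emeasurable_funM.
    by apply/measurable_EFinP; exact: measurableT_comp (wt_meas j) measurable_snd.
  apply: measurableT_comp nF.1 _; apply: measurable_coord => k; rewrite /setc.
  case: eqP => _; first exact: measurable_snd.
  case: eqP => _; [exact: measurable_fst|exact: measurable_cst].
have f0 p : 0 <= f p by rewrite !mule_ge0 ?lee_fin// nF.2.
transitivity (\int[m i]_x \int[m j]_y f (x, y)).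
  apply: eq_integral => x _; rewrite /f/= ge0_integralZl//.
  - exact: (nnmeas_integrand j (setc w i x) nF).1.
  - by move=> y _; exact: (nnmeas_integrand j (setc w i x) nF).2.
  - by rewrite lee_fin.
rewrite fubini_tonelli//; apply: eq_integral => y _; rewrite /f/=.
under eq_integral do rewrite muleCA (setcC _ _ _ ij).
rewrite ge0_integralZl//.
- exact: (nnmeas_integrand i (setc w j y) nF).1.
- by move=> x _; exact: (nnmeas_integrand i (setc w j y) nF).2.
- by rewrite lee_fin.
Qed.

Lemma int1_ints i l F : i \notin l -> nnmeas F ->
  int1 i (ints l F) = ints l (int1 i F).
Proof.
move=> + nF; elim: l => //= j l ih; rewrite inE negb_or => /andP[ij il].
by rewrite int1C ?ih//; exact: nnmeas_ints.
Qed.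

Lemma intsC l l' F : (forall i, i \in l -> i \notin l') -> nnmeas F ->
  ints l (ints l' F) = ints l' (ints l F).
Proof.
move=> + nF; elim: l => //= i l ih h.
rewrite ih; last by move=> k kl; apply: h; rewrite inE kl orbT.
by rewrite int1_ints//; [apply: h; rewrite mem_head|exact: nnmeas_ints].
Qed.

Lemma ints_rem i l F : uniq l -> i \in l -> nnmeas F ->
  ints l F = int1 i (ints (rem i l) F).
Proof.
move=> + + nF; elim: l => //= j l ih /andP[jl ul]; rewrite inE.
have [->//|ij] := eqVneq i j; rewrite /= => il.
by rewrite ih//= int1C//; [rewrite eq_sym|exact: nnmeas_ints].
Qed.

Lemma ints_prod l (f : I -> R -> \bar R) w : uniq l ->
  (forall i, i \in l -> measurable_fun setT (f i)) ->
  (forall i x, i \in l -> 0 <= f i x) ->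
  ints l (fun v => \prod_(i <- l) f i (v i)) w =
  \prod_(i <- l) \int[m i]_x ((wt i x)%:E * f i x).
Proof.
elim: l w => [w _ _ _|i l ih w /= /andP[il ul] mf f0]; first by rewrite /= !big_nil.
have mfl k : k \in l -> measurable_fun setT (f k).
  by move=> kl; apply: mf; rewrite inE kl orbT.
have f0l k x : k \in l -> 0 <= f k x.
  by move=> kl; apply: f0; rewrite inE kl orbT.
have fi0 x : 0 <= f i x by apply: f0; rewrite mem_head.
have nP : nnmeas (fun v => \prod_(k <- l) f k (v k)).
  apply: nnmeas_prod => k kl; split => [|v]; last exact: f0l.
  by apply: measurableT_comp (measurable_eval k); exact: mfl.
have c0 : 0 <= \prod_(j <- l) \int[m j]_x ((wt j x)%:E * f j x).
  rewrite big_seq; elim/big_rec: _ => // j y jl y0; rewrite mule_ge0//.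
  by apply: integral_ge0 => x _; rewrite mule_ge0 ?lee_fin// f0l.
rewrite big_cons muleC -ge0_integralZl//; first last.
- by move=> x _; rewrite mule_ge0// lee_fin.
- by apply: emeasurable_funM; [exact/measurable_EFinP|apply: mf; rewrite mem_head].
apply: eq_integral => x _.
rewrite [RHS]muleCA; congr (_ * _); rewrite -(ih (setc w i x))// muleC.
rewrite -(intsZ _ _ (c := f i x))//; apply: eq_ints => v hv.
by rewrite big_cons hv// setc_eq muleC.
Qed.

End IteratedIntegrals.

(** * Entropy inequalities *)

Section Entropy.
Variable R : realType.
Implicit Types (q z t m : R).

(** From [expR (- u) >= 1 - u] one gets [expR u * (1 - u) <= 1], while the right side times [1 - u]
    is [1 + u ^+ 2 * (1 - 2 * u) >= 1]. Only an upper bound on [u] is required. *)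
Lemma expR_le_quadratic (u : R) : u <= 2^-1 -> expR u <= 1 + u + 2 * u ^+ 2.
Proof.
move=> u2; have u1 : 0 < 1 - u by lra.
have h : expR u * (1 - u) <= 1.
  rewrite -[leRHS](mulfV (lt0r_neq0 (expR_gt0 u))) -expRN ler_wpM2l ?expR_ge0//.
  exact: expR_ge1Dx.
rewrite -(ler_pM2r u1); apply: le_trans h _.
have -> : (1 + u + 2 * u ^+ 2) * (1 - u) = 1 + u ^+ 2 * (1 - 2 * u) by ring.
by rewrite lerDl mulr_ge0 ?sqr_ge0//; lra.
Qed.

Lemma ln_le_subr1 (y : R) : 0 < y -> ln y <= y - 1.
Proof. by move=> y0; have := expR_ge1Dx (ln y); rewrite lnK//; lra. Qed.

(** With [p = q / z] this is [z * (- p * ln p)], the entropy term of one arm scaled by the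
    normalising constant. It is homogeneous of degree one, hence suited to unnormalised
    posteriors. *)
Definition ent q z := q * ln (z / q).

Lemma ent0 z : ent 0 z = 0. Proof. by rewrite /ent mul0r. Qed.

Lemma ent_ge0 q z : 0 <= q -> q <= z -> 0 <= ent q z.
Proof.
rewrite le_eqVlt => /predU1P[<-|q0] qz; first by rewrite ent0.
by rewrite mulr_ge0 ?(ltW q0)// ln_ge0// ler_pdivlMr// mul1r.
Qed.

(* [ln y <= y - 1] at [y = z * eps * expR (t * (r - m)) / q]. All terms are kept
   nonnegative on both sides so that the inequality can be integrated in [\bar R]. *)
Lemma ent_fenchel q z r m t eps : 0 <= q -> q <= z -> 0 <= r <= 1 ->
  0 <= m <= 1 -> 0 <= t <= 2^-1 -> 0 < eps <= 1 ->
  t * r * q + ent q z + q + z * eps * t * m <=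
  q * (- ln eps + t * m) + z * eps * (1 + t * r + 2 * t ^+ 2).
Proof.
move=> q0 qz /andP[r0 r1] /andP[m0 m1] /andP[t0 t1] /andP[e0 e1].
have z0 : 0 <= z by exact: le_trans qz.
pose u := t * (r - m).
have u2 : u <= 2^-1.
  by rewrite (le_trans _ t1)// /u -[leRHS]mulr1 ler_wpM2l//; lra.
have uq : u ^+ 2 <= t ^+ 2.
  rewrite /u exprMn -[leRHS]mulr1 ler_wpM2l ?sqr_ge0//.
  have h1 : 0 <= 1 - (r - m) by lra.
  have h2 : 0 <= 1 + (r - m) by lra.
  by have := mulr_ge0 h1 h2; lra.
have he : z * eps * expR u <= z * eps * (1 + u + 2 * t ^+ 2).
  rewrite ler_wpM2l ?(mulr_ge0 z0 (ltW e0))// (le_trans (expR_le_quadratic u2))//.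
  by rewrite lerD2l ler_wpM2l.
(* The point [y] divides by [q], so [q = 0] is separate; there the claim reduces to
   [t * m <= 1 + t * r + 2 * t ^+ 2]. *)
move: q0; rewrite le_eqVlt => /predU1P[q0|q0].
  rewrite -q0 ent0 !mul0r mulr0 !add0r -[leLHS]mulrA ler_wpM2l ?(mulr_ge0 z0 (ltW e0))//.
  have : t * m <= 1 by rewrite -[leRHS](mulr1 1) ler_pM//; lra.
  by have := sqr_ge0 t; have := mulr_ge0 t0 r0; lra.
have zp : 0 < z by exact: lt_le_trans qz.
have hl : q * ln (z / q * eps * expR u) <= q * (z / q * eps * expR u - 1).
  by rewrite ler_wpM2l ?(ltW q0)// ln_le_subr1// !mulr_gt0 ?invr_gt0 ?expR_gt0.
rewrite lnM ?posrE ?expR_gt0 ?mulr_gt0 ?invr_gt0// in hl.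
rewrite lnM ?posrE ?mulr_gt0 ?invr_gt0// expRK in hl.
have e : q * (z / q * eps * expR u - 1) = z * eps * expR u - q.
  by field; rewrite lt0r_neq0.
rewrite e in hl; rewrite /ent /u in hl he *; lra.
Qed.

(* With [p := q / z], take [eps = p] and [t = lam / (2 * p)] if [lam <= p];
   otherwise [m1 <= q <= lam * z] already. *)
Lemma ent_step q z m0 m1 EH lam : 0 < z -> 0 <= q -> q <= z -> 0 <= m1 ->
  m1 <= q -> 0 <= m0 -> 0 < lam ->
  (forall eps t, 0 < eps <= 1 -> 0 <= t <= 2^-1 ->
     t * m1 + EH + q <= q * - ln eps + q * t * (m0 / z) + z * eps * (1 + 2 * t ^+ 2)) ->
  m1 + 2 * (q / z) / lam * EH <=
  2 * (q / z) / lam * ent q z + q / z * m0 + lam * z.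
Proof.
move=> z0 + qz m10 m1q m00 l0 key; rewrite le_eqVlt => /predU1P[q0|q0].
  have -> : m1 = 0 by apply/le_anti; rewrite m10 q0 m1q.
  by rewrite -q0 !(mul0r, mulr0, add0r) mulr_ge0 ?ltW.
have [p pE] : exists p, p = q / z by exists (q / z).
have p0 : 0 < p by rewrite pE divr_gt0.
have p1 : p <= 1 by rewrite pE ler_pdivrMr// mul1r.
have lnp : - ln p = ln (z / q).
  by rewrite -lnV ?posrE// pE invf_div.
have qp : q = p * z by rewrite pE divfK// lt0r_neq0.
rewrite -pE; have [lp|lp] := leP lam p.
  have [t tE] : exists t, t = lam / (2 * p) by exists (lam / (2 * p)).
  have t0 : 0 < t by rewrite tE divr_gt0// mulr_gt0.
  have t1 : t <= 2^-1 by rewrite tE ler_pdivrMr ?mulr_gt0//; lra.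
  have := key p t; rewrite p0 p1 (ltW t0) t1 => /(_ isT isT).
  rewrite lnp -/(ent q z) => k.
  have tV : 2 * p / lam = t^-1 by rewrite tE invf_div.
  rewrite tV -(ler_pM2l t0).
  have -> : t * (m1 + t^-1 * EH) = t * m1 + EH.
    by field; rewrite lt0r_neq0.
  have -> : t * (t^-1 * ent q z + p * m0 + lam * z) =
     ent q z + q * t * (m0 / z) + z * p * 2 * t ^+ 2.
    rewrite {3}qp tE; field.
    by rewrite !lt0r_neq0.
  by move: k; lra.
(* At [t = 0] the hypothesis says that the entropy term does not increase, so the two entropy terms
   compare directly. *)
have := key p 0; rewrite p0 p1 lexx invr_ge0 ler0n => /(_ isT isT).
rewrite lnp -/(ent q z) => k.
have kEH : EH <= ent q z by move: k; lra.
have h1 : 2 * p / lam * EH <= 2 * p / lam * ent q z.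
  by rewrite ler_wpM2l// divr_ge0 ?(ltW l0)// mulr_ge0 ?(ltW p0).
have h2 : m1 <= lam * z.
  by rewrite (le_trans m1q)// qp ler_wpM2r ?(ltW z0) ?(ltW lp).
by have := mulr_ge0 (ltW p0) m00; lra.
Qed.

(** Jensen's inequality for the concave function [ent], in dual form: the right side of the
    hypothesis is smallest at [eps = q / z]. For [q = 0] there is no minimiser, and a small [eps]
    refutes [EH > 0]. *)
Lemma ent_jensen q z EH : 0 < z -> 0 <= q -> q <= z ->
  (forall eps, 0 < eps <= 1 -> EH + q <= q * - ln eps + z * eps) ->
  EH <= ent q z.
Proof.
move=> z0 + qz key; rewrite le_eqVlt => /predU1P[q0|q0].
  rewrite -q0 ent0 leNgt; apply/negP => EH0.
  pose e := Num.min 1 (EH / (2 * z)).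
  have e0 : 0 < e by rewrite lt_min ltr01 divr_gt0// mulr_gt0.
  have e1 : e <= 1 by rewrite ge_min lexx.
  have := key e; rewrite e0 e1 -q0 mul0r addr0 add0r => /(_ isT) h.
  have : z * e <= z * (EH / (2 * z)) by rewrite ler_wpM2l ?(ltW z0)// ge_min lexx orbT.
  have -> : z * (EH / (2 * z)) = EH / 2 by field; rewrite lt0r_neq0.
  by lra.
have p0 : 0 < q / z by rewrite divr_gt0.
have p1 : q / z <= 1 by rewrite ler_pdivrMr// mul1r.
have := key (q / z); rewrite p0 p1 => /(_ isT).
rewrite -lnV ?posrE// invf_div -/(ent q z) [z * _]mulrC divfK ?lt0r_neq0//.
by lra.
Qed.

(** Comparison with the uniform distribution: [ent_fenchel] at [t = 0] and [eps = K%:R^-1], summed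
    over the arms. *)
Lemma ent_max (K : nat) (q : 'I_K -> R) : (0 < K)%N -> (forall a, 0 <= q a) ->
  \sum_a q a = 1 -> \sum_a ent (q a) 1 <= ln K%:R.
Proof.
move=> K0 q0 q1; have K1 : 0 < K%:R :> R by rewrite ltr0n.
have h a : ent (q a) 1 + q a <= q a * ln K%:R + K%:R^-1.
  have qa : q a <= 1.
    by rewrite -q1 (bigD1 a)//= lerDl sumr_ge0.
  have := @ent_fenchel (q a) 1 0 0 0 K%:R^-1 (q0 a) qa.
  rewrite !lexx ler01 invr_ge0 ler0n invr_gt0 K1 invf_le1// ler1n K0.
  move=> /(_ isT isT isT isT); rewrite lnV ?posrE//; lra.
have : \sum_a (ent (q a) 1 + q a) <= \sum_a (q a * ln K%:R + K%:R^-1).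
  by apply: ler_sum => a _.
rewrite !big_split/= q1 -mulr_suml q1 sumr_const card_ord.
rewrite -[K%:R^-1 *+ K]mulr_natr mulVf ?lt0r_neq0//.
by lra.
Qed.

(* On each fibre [acts n = a] the weights of the other agents sum to 1, and the
   weight of agent [n] is the factor [p n a] of the hypothesis. *)
Lemma batch_sum (N K : nat) (p : 'I_N -> 'I_K -> R) (n : 'I_N)
    (f : {ffun 'I_N -> 'I_K} -> R) (m : 'I_K -> R) (c : R) :
  (forall n a, 0 <= p n a) -> (forall n, \sum_a p n a = 1) ->
  (forall acts : {ffun 'I_N -> 'I_K}, m (acts n) <= p n (acts n) * f acts + c) ->
  \sum_a m a <= \sum_(acts : {ffun 'I_N -> 'I_K}) (\prod_k p k (acts k)) * f acts + K%:R * c.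
Proof.
move=> p0 p1 h; pose rest (acts : {ffun 'I_N -> 'I_K}) := \prod_(k | k != n) p k (acts k).
have rest0 acts : 0 <= rest acts by apply: prodr_ge0.
have rest1 a : \sum_(acts : {ffun 'I_N -> 'I_K} | acts n == a) rest acts = 1.
  (* Replacing row [n] of [p] by the point mass at [a] turns the sum over a fibre into a product of
     row sums, each equal to 1. *)
  pose F k b := if k == n then (b == a)%:R else p k b.
  have <- : \prod_k \sum_b F k b = 1.
    apply: big1 => k _; rewrite /F; case: eqP => _; last exact: p1.
    by rewrite (bigD1 a)//= eqxx big1 ?addr0// => b /negPf ->.
  rewrite bigA_distr_bigA big_mkcond/=; apply: eq_bigr => acts _.
  rewrite (bigD1 n)//= {1}/F eqxx; case: eqP => _; last by rewrite mul0r.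
  by rewrite mul1r; apply: eq_bigr => k /negPf kn; rewrite /F kn.
have -> : \sum_a m a = \sum_acts rest acts * m (acts n).
  rewrite (partition_big (fun acts : {ffun 'I_N -> 'I_K} => acts n) xpredT)//=.
  apply: eq_bigr => a _; rewrite -[LHS]mul1r -(rest1 a) mulr_suml.
  by apply: eq_bigr => acts /eqP ->.
have -> : K%:R * c = \sum_acts rest acts * c.
  rewrite -mulr_suml (partition_big (fun acts : {ffun 'I_N -> 'I_K} => acts n) xpredT)//=.
  under eq_bigr do rewrite rest1.
  by rewrite sumr_const card_ord.
rewrite -big_split/=; apply: ler_sum => acts _.
rewrite (bigD1 n)//= -/(rest acts) [_ * rest _]mulrC -mulrA -mulrDr.
by rewrite ler_wpM2l.
Qed.

End Entropy.

(** * Measurability of inverses, indicators and parametrised integrals *)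

Section MeasurabilityComplements.
Context d (T : measurableType d) (R : realType).

Lemma measurable_natmul_bool (f : T -> bool) :
  measurable_fun setT f -> measurable_fun setT (fun t => (f t)%:R : R).
Proof.
move=> mf; apply: (measurableT_comp (f := fun b : bool => b%:R : R) _ mf).
by move=> _ B _.
Qed.

(** On [f t > 0] the inverse is [expR (- ln (f t))]; the indicator factor reproduces the convention
    that the inverse of 0 is 0. *)
Lemma measurable_inv_ge0 (f : T -> R) : (forall t, 0 <= f t) ->
  measurable_fun setT f -> measurable_fun setT (fun t => (f t)^-1).
Proof.
move=> f0 mf.
have -> : (fun t => (f t)^-1) =
    (fun t => expR (- ln (f t)) * (0 < f t)%R%:R).
  apply/funext => t; have := f0 t; rewrite le_eqVlt => /predU1P[<-|ft].
    by rewrite invr0 ltxx mulr0.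
  by rewrite ft mulr1 expRN lnK.
apply: measurable_funM.
  apply: measurableT_comp; first exact: measurable_expR.
  by apply: measurableT_comp => //; apply: measurableT_comp => //; exact: measurable_ln.
by apply: measurable_natmul_bool; exact: measurable_fun_ltr.
Qed.

Lemma measurable_integral_param (mu : {sigma_finite_measure set R -> \bar R})
    (f : T * R -> R) : measurable_fun setT f -> (forall p, 0 <= f p) ->
  measurable_fun setT (fun t => \int[mu]_x (f (t, x))%:E)%E.
Proof.
move=> mf f0; apply: (measurable_fun_fubini_tonelli_F (m2 := mu) (EFin \o f)).
  exact/measurable_EFinP.
by move=> p; rewrite lee_fin.
Qed.

Lemma measurable_fine (f : T -> \bar R) :
  measurable_fun setT f -> measurable_fun setT (fun t => fine (f t)).
Proof. by move=> mf; apply: measurableT_comp mf; exact: fine_measurable. Qed.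

End MeasurabilityComplements.

(** * Thompson Sampling in a model with everywhere measurable data *)

Section RegularModel.
Variables (R : realType) (S : finType) (K : nat).
Variables (PSw : S -> R) (nu0 : {sigma_finite_measure set R -> \bar R}).
Variables (b T eta A : R -> R) (Th : set R) (pri : S -> 'I_K -> probability R R).
Hypotheses (mb : measurable_fun setT b) (mT : measurable_fun setT T).
Hypotheses (meta : measurable_fun setT eta) (mA : measurable_fun setT A).
Hypothesis b_ge0 : forall r, 0 <= b r.
Hypothesis b_out : forall r, b r != 0 -> 0 <= r <= 1.

Definition regmodel := TSModel PSw nu0 b T eta A Th pri.
Notation M := regmodel.

Definition ell (x r : R) : R := expR (eta x * T r - A x).

Hypothesis dens1 : forall x, (\int[nu0]_r (b r * ell x r)%:E = 1)%E.

Lemma ell_gt0 x r : 0 < ell x r. Proof. exact: expR_gt0. Qed.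

Lemma measurable_ell d (U : measurableType d) (f g : U -> R) :
  measurable_fun setT f -> measurable_fun setT g ->
  measurable_fun setT (fun u => ell (f u) (g u)).
Proof.
move=> mf mg; apply: measurableT_comp; first exact: measurable_expR.
apply: measurable_funB; last exact: measurableT_comp mA mf.
by apply: measurable_funM; [exact: measurableT_comp meta mf|exact: measurableT_comp mT mg].
Qed.

(** Since [b] vanishes outside [[0, 1]], rewards may range over the whole line and become
    coordinates like the parameters. *)
Lemma integral_b (f : R -> R) :
  (\int[nu0]_(r in `[0%R, 1%R]) (b r * f r)%:E =
   \int[nu0]_r ((b r)%:E * (f r)%:E))%E.
Proof.
rewrite integral_mkcond; apply: eq_integral => r _; rewrite patchE.
case: ifPn => //; rewrite notin_setE/= in_itv/= => /negP h.
have [->|/b_out//] := eqVneq (b r) 0; first by rewrite mul0e.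
by rewrite (negPf h).
Qed.

(** The expectation of [rho] of a reward with parameter [x]. It is used with [rho = 1], where it is
    the total mass, and [rho = Num.norm], where it is the mean. *)
Definition kap (rho : R -> R) (x : R) : \bar R :=
  (\int[nu0]_r ((b r)%:E * (ell x r * rho r)%:E))%E.

Lemma kap1 x : kap (cst 1) x = 1%E.
Proof. by rewrite -(dens1 x); apply: eq_integral => r _; rewrite mulr1 EFinM. Qed.

Lemma measurable_kap_integrand (rho : R -> R) x : measurable_fun setT rho ->
  measurable_fun setT (fun r => (b r)%:E * (ell x r * rho r)%:E)%E.
Proof.
move=> mr; apply/measurable_EFinP; apply: measurable_funM => //.
by apply: measurable_funM => //; exact: measurable_ell.
Qed.

(** The absolute value keeps the integrand nonnegative on the whole line; where [b] is nonzero the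
    reward is its own absolute value. *)
Lemma meanE x : (mean_of M x)%:E = kap Num.norm x.
Proof.
have -> : mean_of M x = fine (kap Num.norm x).
  rewrite /mean_of /=; congr fine; rewrite /kap -integral_b.
  apply: eq_integral => r; rewrite inE/= in_itv/= => /andP[r0 _].
  by congr EFin; rewrite /dens /= -/(ell x r) ger0_norm// mulrC -mulrA.
rewrite fineK// fin_real//; apply/andP; split.
  apply: (@lt_le_trans _ _ 0%E) => //; apply: integral_ge0 => r _.
  by rewrite mule_ge0// lee_fin ?b_ge0// mulr_ge0// ltW// ell_gt0.
apply: (@le_lt_trans _ _ (kap (cst 1) x)); last by rewrite kap1 ltry.
apply: ge0_le_integral => //.
- by move=> r _; rewrite mule_ge0// lee_fin ?b_ge0// mulr_ge0// ltW// ell_gt0.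
- by apply: measurable_kap_integrand; exact: normr_measurable.
- exact: measurable_kap_integrand.
move=> r _; have [->|/b_out/andP[r0 r1]] := eqVneq (b r) 0; first by rewrite !mul0e.
apply: lee_wpmul2l; first by rewrite lee_fin.
by rewrite lee_fin ler_wpM2l//= ?ger0_norm// ltW// ell_gt0.
Qed.

Lemma mean_ge0 x : 0 <= mean_of M x.
Proof.
rewrite -lee_fin meanE; apply: integral_ge0 => r _.
by rewrite mule_ge0// lee_fin ?b_ge0// mulr_ge0// ltW// ell_gt0.
Qed.

Lemma mean_le1 x : mean_of M x <= 1.
Proof.
rewrite -lee_fin meanE -[leRHS](kap1 x).
apply: ge0_le_integral => //.
- by move=> r _; rewrite mule_ge0// lee_fin ?b_ge0// mulr_ge0// ltW// ell_gt0.
- by apply: measurable_kap_integrand; exact: normr_measurable.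
- exact: measurable_kap_integrand.
move=> r _; have [->|/b_out/andP[r0 r1]] := eqVneq (b r) 0; first by rewrite !mul0e.
apply: lee_wpmul2l; first by rewrite lee_fin.
by rewrite lee_fin ler_wpM2l//= ?ger0_norm// ltW// ell_gt0.
Qed.

Lemma measurable_mean : measurable_fun setT (mean_of M).
Proof.
have -> : mean_of M = fun x => fine (\int[nu0]_r (b r * (ell x r * `|r|))%:E)%E.
  apply/funext => x; rewrite -[LHS]/(fine (mean_of M x)%:E) meanE.
  by congr fine; apply: eq_integral => r _; rewrite EFinM.
apply: measurable_fine.
apply: (measurable_integral_param nu0 (f := fun p => b p.2 * (ell p.1 p.2 * `|p.2|))).
  apply: measurable_funM; first exact: measurableT_comp mb measurable_snd.
  apply: measurable_funM.
    by apply: measurable_ell; [exact: measurable_fst|exact: measurable_snd].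
  by apply: measurableT_comp measurable_snd; exact: normr_measurable.
by move=> p; rewrite !mulr_ge0// ltW// ell_gt0.
Qed.

(** * Parameters and rewards as coordinates; likelihoods and optimal arms *)

Notation Idx := (S * 'I_K + nat)%type.
Notation Om := (Coord R Idx).

(* Coordinate [inl (s, a)] is the parameter of arm [a] in context [s], coordinate
   [inr i] the [i]-th observed reward. The factor [b] of the reward density is a
   weight of the integral, so that likelihoods are free of [b] as in [lik]. *)
Definition mI (i : Idx) : {sigma_finite_measure set R -> \bar R} :=
  match i with inl p => pri p.1 p.2 | inr _ => nu0 end.

Definition wI (i : Idx) : R -> R :=
  match i with inl _ => cst 1 | inr _ => b end.

Lemma wI_meas i : measurable_fun setT (wI i).
Proof. by case: i => //= p; exact: measurable_cst. Qed.

Lemma wI_ge0 i x : 0 <= wI i x.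
Proof. by case: i => //=. Qed.

Definition thof (w : Om) : instance R S K := fun s a => w (inl (s, a)).
Definition rewards (m k : nat) (w : Om) : seq R := [seq w (inr i) | i <- iota m k].
(** The pulls are fixed and only the rewards vary with [w], which makes a history a function on the
    coordinate space; [m] counts the pulls made before. *)
Definition obs (m : nat) (qs : seq (S * 'I_K)) (w : Om) : history R S K :=
  zip qs (rewards m (size qs) w).
Definition params : seq Idx := map inl (enum [set: S * 'I_K]).

Lemma obs_cons m q qs w :
  obs m (q :: qs) w = (q, w (inr m)) :: obs m.+1 qs w.
Proof. by []. Qed.

Lemma obs_cat m ps qs w :
  obs m (ps ++ qs) w = obs m ps w ++ obs (m + size ps) qs w.
Proof.
elim: ps m => [|p ps ih] m /=; first by rewrite addn0.
by rewrite !obs_cons ih addSnnS.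
Qed.

Lemma eq_obs m qs v w :
  (forall i, (m <= i < m + size qs)%N -> v (inr i) = w (inr i)) ->
  obs m qs v = obs m qs w.
Proof.
elim: qs m => [//|q qs ih] m h; rewrite !obs_cons h ?leqnn ?addnS ?ltnS ?leq_addr//.
by rewrite ih// => i /andP[mi im]; apply: h; rewrite (ltnW mi) /= addnS -addSn.
Qed.

Lemma mem_params (i : Idx) : (i \in params) = (if i is inl _ then true else false).
Proof.
case: i => [p|n]; first by rewrite mem_map ?mem_enum ?in_setT//; exact: inl_inj.
by apply/negbTE/mapP => -[].
Qed.

Lemma uniq_params : uniq params.
Proof. by rewrite map_inj_uniq ?enum_uniq//; exact: inl_inj. Qed.

Definition Lik (h : history R S K) (t : instance R S K) : R :=
  \prod_(o <- h) ell (t o.1.1 o.1.2) o.2.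

Lemma Lik_gt0 h t : 0 < Lik h t.
Proof. by apply: prodr_gt0 => o _; exact: ell_gt0. Qed.

Lemma Lik_cat h h' t : Lik (h ++ h') t = Lik h t * Lik h' t.
Proof. exact: big_cat. Qed.

Lemma lik_gt0 h s a x : 0 < lik M h s a x.
Proof. by apply: prodr_gt0 => o _; exact: expR_gt0. Qed.

(** Observations are grouped by pair. Because the likelihood factors in this way and the priors are
    independent, posteriors remain products over the pairs. *)
Lemma LikE h t : Lik h t = \prod_(p : S * 'I_K) lik M h p.1 p.2 (t p.1 p.2).
Proof.
rewrite /Lik (partition_big (fun o : S * 'I_K * R => o.1) xpredT)//=.
apply: eq_bigr => -[s a] _ /=; rewrite /lik; apply: eq_big => [[[s' a'] r]|[[s' a'] r]] /=.
  by [].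
by move=> /eqP[-> ->].
Qed.

Lemma measurable_lik d (U : measurableType d) (f : U -> Om) (g : U -> R) m qs s a :
  measurable_fun setT f -> measurable_fun setT g ->
  measurable_fun setT (fun u => lik M (obs m qs (f u)) s a (g u)).
Proof.
move=> mf mg; elim: qs m => [|q qs ih] m.
  by under eq_fun do rewrite /lik big_nil; exact: measurable_cst.
under eq_fun do rewrite /lik obs_cons big_cons/=.
case: ((q.1 == s) && (q.2 == a)); last exact: ih.
apply: measurable_funM; last exact: ih.
by apply: measurable_ell => //; exact: measurableT_comp (measurable_eval _) mf.
Qed.

Lemma measurable_thof d (U : measurableType d) (f : U -> Om) s a :
  measurable_fun setT f -> measurable_fun setT (fun u => thof (f u) s a).
Proof. by move=> mf; exact: measurableT_comp (measurable_eval _) mf. Qed.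

Lemma measurable_Lik d (U : measurableType d) (f : U -> Om) m qs :
  measurable_fun setT f ->
  measurable_fun setT (fun u => Lik (obs m qs (f u)) (thof (f u))).
Proof.
move=> mf; under eq_fun do rewrite LikE; apply: measurable_prod => p _.
by apply: measurable_lik => //; exact: measurable_thof.
Qed.

(* [beats a a' x y]: with parameters x for arm a and y for arm a', arm a wins
   the argmax against a' under the smallest-index tie-breaking rule. *)
Definition beats (a a' : 'I_K) (x y : R) : bool :=
  if (a' < a)%N then mean_of M y < mean_of M x else mean_of M y <= mean_of M x.

(** The indicator that [a] is the optimal arm, written as a product over the competitors to match
    the product in [ts_prob]. *)
Definition opt (s : S) (a : 'I_K) (t : instance R S K) : R :=
  \prod_(a' < K | a' != a) (beats a a' (t s a) (t s a'))%:R.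

Lemma measurable_beats d (U : measurableType d) (f g : U -> R) a a' :
  measurable_fun setT f -> measurable_fun setT g ->
  measurable_fun setT (fun u => (beats a a' (f u) (g u))%:R : R).
Proof.
move=> mf mg; apply: measurable_natmul_bool; rewrite /beats; case: (a' < a)%N.
  by apply: measurable_fun_ltr; exact: measurableT_comp measurable_mean _.
by apply: measurable_fun_ler; exact: measurableT_comp measurable_mean _.
Qed.

Lemma measurable_opt d (U : measurableType d) (f : U -> Om) s a :
  measurable_fun setT f -> measurable_fun setT (fun u => opt s a (thof (f u))).
Proof.
move=> mf; rewrite /opt; under eq_fun do rewrite big_mkcond/=.
apply: measurable_prod => a' _; case: (a' != a); last exact: measurable_cst.
by apply: measurable_beats; exact: measurable_thof.
Qed.

Lemma opt_ge0 s a t : 0 <= opt s a t.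
Proof. by apply: prodr_ge0 => a' _; case: beats. Qed.

Lemma optE s a t :
  opt s a t = [forall a', (a' != a) ==> beats a a' (t s a) (t s a')]%:R.
Proof.
rewrite /opt; case: forallP => [h|h].
  by rewrite big1// => a' na; have /implyP/(_ na) -> := h a'.
apply/eqP; rewrite prodf_seq_eq0; apply/hasP.
move/existsP : (introN forallP h) => [a']; rewrite negb_imply => /andP[na nb].
by exists a'; rewrite ?mem_index_enum// na /= (negPf nb).
Qed.

Lemma beats_irr s (t : instance R S K) a a' :
  a != a' -> beats a a' (t s a) (t s a') -> ~~ beats a' a (t s a') (t s a).
Proof.
move=> na; rewrite /beats; case: (ltngtP a' a) => [lt|lt|/val_inj e].
- by rewrite -ltNge.
- by rewrite -leNgt.
- by rewrite e eqxx in na.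
Qed.

(** The winner is the maximiser of least index. *)
Lemma opt_exists s (t : instance R S K) : (0 < K)%N ->
  exists a, forall a', a' != a -> beats a a' (t s a) (t s a').
Proof.
move=> K0; pose mm a := mean_of M (t s a).
have [a0 ha0] : exists a0, forall a', mm a' <= mm a0.
  exists [arg max_(a > Ordinal K0) mm a]%O.
  by case: (arg_maxP mm) => // a _ h a'; exact: h.
have ex : exists n, [exists a : 'I_K, (val a == n) && [forall a', mm a' <= mm a]].
  exists (val a0); apply/existsP; exists a0; rewrite eqxx/=; exact/forallP.
case: (ex_minnP ex) => n /existsP[a /andP[/eqP an /forallP amax]] nmin.
exists a => a' na; rewrite /beats; case: ifP => [lt|_]; last exact: amax.
rewrite lt_neqAle amax andbT; apply/eqP => e.
have : (n <= a')%N.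
  apply: nmin; apply/existsP; exists a'; rewrite eqxx; apply/forallP => a''.
  by rewrite /mm e; exact: amax.
by rewrite -an leqNgt lt.
Qed.

Lemma opt_unique s (t : instance R S K) : (0 < K)%N ->
  exists a, forall a', opt s a' t = (a' == a)%:R.
Proof.
move=> K0; have [a ha] := opt_exists s t K0; exists a => a'.
rewrite optE; congr (nat_of_bool _)%:R; apply/idP/eqP => [/forallP h|->].
  apply/eqP/negPn/negP => na.
  have h1 : beats a' a (t s a') (t s a).
    by apply: (implyP (h a)); rewrite eq_sym.
  have /negP := beats_irr na h1; apply; exact: ha.
by apply/forallP => a''; apply/implyP; exact: ha.
Qed.

Lemma opt_sum s t : (0 < K)%N -> \sum_(a < K) opt s a t = 1.
Proof.
move=> K0; have [a ha] := opt_unique s t K0.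
by rewrite (bigD1 a)//= big1 ?addr0 => [|a' na]; rewrite ha ?eqxx// (negPf na).
Qed.

Lemma opt_le1 s a t : opt s a t <= 1.
Proof. by rewrite optE; case: [forall _, _]. Qed.

(** Splitting the maximum according to which arm is optimal makes it measurable and lets the regret
    be treated arm by arm. The initial value 0 of the maximum does no harm because means are
    nonnegative. *)
Lemma mustarE s (t : instance R S K) : (0 < K)%N ->
  mustar M t s = \sum_(a < K) mean_of M (t s a) * opt s a t.
Proof.
move=> K0; have [a ha] := opt_unique s t K0.
have -> : \sum_(a < K) mean_of M (t s a) * opt s a t = mean_of M (t s a).
  rewrite (bigD1 a)//= big1 ?addr0 => [|a' na]; rewrite ha ?eqxx ?mulr1//.
  by rewrite (negPf na) mulr0.
have : opt s a t = 1 by rewrite ha eqxx.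
rewrite optE; case: forallP => [h _|_ /eqP]; last by rewrite eq_sym oner_eq0.
have amax a' : mean_of M (t s a') <= mean_of M (t s a).
  have [->//|na] := eqVneq a' a.
  by have /implyP/(_ na) := h a'; rewrite /beats; case: ifP => // _ /ltW.
apply/le_anti/andP; split; last exact: (le_bigmax_cond _ (fun a' => mean_of M (t s a'))).
by apply/bigmax_leP; split => //; exact: mean_ge0.
Qed.

Lemma mustar_ge s a t : mean_of M (t s a) <= mustar M t s.
Proof. exact: (le_bigmax_cond _ (fun a' => mean_of M (t s a'))). Qed.

Lemma mustar_le1 s t : mustar M t s <= 1.
Proof. by apply/bigmax_leP; split => // a _; exact: mean_le1. Qed.

Lemma measurable_mustar d (U : measurableType d) (f : U -> Om) s :
  (0 < K)%N -> measurable_fun setT f ->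
  measurable_fun setT (fun u => mustar M (thof (f u)) s).
Proof.
move=> K0 mf; under eq_fun do rewrite mustarE//.
apply: measurable_sum => a; apply: measurable_funM; last exact: measurable_opt.
by apply: measurableT_comp measurable_mean _; exact: measurable_thof.
Qed.

(** * Normalising constants and the Thompson Sampling probabilities *)

Notation ints := (ints mI wI).

Definition zof (h : history R S K) (p : S * 'I_K) : \bar R :=
  (\int[pri p.1 p.2]_x (lik M h p.1 p.2 x)%:E)%E.

Lemma measurable_lik1 m qs w s a :
  measurable_fun setT (fun x => lik M (obs m qs w) s a x).
Proof. by apply: (measurable_lik (f := cst w)) => //; exact: measurable_cst. Qed.

(** A zero integral would make the everywhere positive likelihood vanish almost everywhere, so the
    whole line would be null for a probability. *)
Lemma zof_gt0 m qs w p : (0 < zof (obs m qs w) p)%E.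
Proof.
rewrite lt_def; apply/andP; split; last first.
  by apply: integral_ge0 => x _; rewrite lee_fin ltW// lik_gt0.
apply/eqP => z0.
have aez : ae_eq (pri p.1 p.2) setT
    (fun x => (lik M (obs m qs w) p.1 p.2 x)%:E) (cst 0%E).
  apply/ae_eq_integral_abs => //.
    by apply/measurable_EFinP; exact: measurable_lik1.
  rewrite -[RHS]z0; apply: eq_integral => x _.
  by rewrite gee0_abs// lee_fin ltW// lik_gt0.
have [B [mB B0 sB]] : (pri p.1 p.2).-negligible
  (~` [set x | setT x -> (lik M (obs m qs w) p.1 p.2 x)%:E = cst 0%E x]) := aez.
have BT : B = setT.
  apply/seteqP; split => // x _; apply: sB => /= /(_ Logic.I) [] h.
  by have := lik_gt0 (obs m qs w) p.1 p.2 x; rewrite h ltxx.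
by have := probability_setT (pri p.1 p.2); rewrite -BT B0 => -[] /eqP; rewrite eq_sym oner_eq0.
Qed.

Definition Zps (ps : seq (S * 'I_K)) (w : Om) : \bar R :=
  ints params (fun v => (Lik (obs 0 ps v) (thof v))%:E) w.

(** The quotient of this by [Zps ps w] is the posterior probability that [a] is optimal in context
    [s]. *)
Definition Qps (ps : seq (S * 'I_K)) (s : S) (a : 'I_K) (w : Om) : \bar R :=
  ints params (fun v => (Lik (obs 0 ps v) (thof v) * opt s a (thof v))%:E) w.

Lemma agree_params m ps v w : agree_off params v w -> obs m ps v = obs m ps w.
Proof. by move=> h; apply: eq_obs => i _; apply: h; rewrite mem_params. Qed.

Lemma prod_params (F : Idx -> \bar R) :
  (\prod_(i <- params) F i = \prod_(p : S * 'I_K) F (inl p))%E.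
Proof.
by rewrite big_map big_enum/=; apply: eq_bigl => p; rewrite in_setT.
Qed.

Lemma ZpsE ps w : Zps ps w = (\prod_(p : S * 'I_K) zof (obs 0 ps w) p)%E.
Proof.
pose f (i : Idx) (x : R) : \bar R :=
  if i is inl p then (lik M (obs 0 ps w) p.1 p.2 x)%:E else 1%E.
transitivity (ints params (fun v => \prod_(i <- params) f i (v i))%E w).
  apply: eq_ints => v /agree_params ->; rewrite prod_params LikE -prodEFin.
  by apply: eq_bigr => -[].
rewrite ints_prod.
- rewrite prod_params; apply: eq_bigr => p _; apply: eq_integral => x _.
  by rewrite mul1e.
- exact: wI_meas.
- exact: wI_ge0.
- exact: uniq_params.
- case=> [p|n] _; last exact: measurable_cst.
  by apply/measurable_EFinP; exact: measurable_lik1.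
- by case=> [p|n] x _ //=; rewrite lee_fin ltW// lik_gt0.
Qed.

Definition wins (a a' : 'I_K) (x : R) : set R :=
  [set y | if (a' < a)%N then mean_of M y < mean_of M x
           else mean_of M y <= mean_of M x].

Lemma postE h s a a' x : post M h s a' (wins a a' x) =
  fine (\int[pri s a']_y (lik M h s a' y * (beats a a' x y)%:R)%:E)%E /
  fine (zof h (s, a')).
Proof.
rewrite /post; congr (fine _ / _); rewrite integral_mkcond.
apply: eq_integral => y _; rewrite patchE /wins /beats.
case: ifPn => [|]; rewrite ?inE ?notin_setE/=.
  by move=> ->; rewrite mulr1.
by move/negP/negPf => ->; rewrite mulr0.
Qed.

Lemma ts_probE h s a : ts_prob M h s a =
  fine (\int[pri s a]_x (lik M h s a x *
     \prod_(a' < K | a' != a) post M h s a' (wins a a' x))%:E)%E /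
  fine (zof h (s, a)).
Proof. by []. Qed.

Lemma measurable_zof d (U : measurableType d) (f : U -> Om) m qs p :
  measurable_fun setT f -> measurable_fun setT (fun u => zof (obs m qs (f u)) p).
Proof.
move=> mf; apply: (measurable_integral_param (pri p.1 p.2)
  (f := fun q => lik M (obs m qs (f q.1)) p.1 p.2 q.2)) => [|q]; last exact/ltW/lik_gt0.
apply: measurable_lik; last exact: measurable_snd.
exact: measurableT_comp mf measurable_fst.
Qed.

Lemma zof_ge0 h p : (0 <= zof h p)%E.
Proof. by apply: integral_ge0 => x _; rewrite lee_fin ltW// lik_gt0. Qed.

Lemma measurable_post d (U : measurableType d) (f : U -> Om) (g : U -> R) m qs s a a' :
  measurable_fun setT f -> measurable_fun setT g ->
  measurable_fun setT (fun u => post M (obs m qs (f u)) s a' (wins a a' (g u))).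
Proof.
move=> mf mg; under eq_fun do rewrite postE; apply: measurable_funM.
  apply: measurable_fine; apply: (measurable_integral_param (pri s a')
    (f := fun q => lik M (obs m qs (f q.1)) s a' q.2 * (beats a a' (g q.1) q.2)%:R)).
    apply: measurable_funM.
      apply: measurable_lik; last exact: measurable_snd.
      exact: measurableT_comp mf measurable_fst.
    apply: measurable_beats; last exact: measurable_snd.
    exact: measurableT_comp mg measurable_fst.
  by move=> q; rewrite mulr_ge0// ltW// lik_gt0.
apply: measurable_inv_ge0 => [u|]; first by rewrite fine_ge0// zof_ge0.
by apply: measurable_fine; exact: measurable_zof.
Qed.

Lemma post_ge0 h s a a' x : 0 <= post M h s a' (wins a a' x).
Proof.
rewrite postE divr_ge0// fine_ge0 ?zof_ge0//; apply: integral_ge0 => y _.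
by rewrite lee_fin mulr_ge0// ltW// lik_gt0.
Qed.

Lemma measurable_lik_beats m qs w s a a' x :
  measurable_fun setT
    (fun y => lik M (obs m qs w) s a' y * (beats a a' x y)%:R).
Proof.
apply: measurable_funM; first exact: measurable_lik1.
exact: (measurable_beats (f := cst x)).
Qed.

Lemma lik_beats_le m qs w s a a' x :
  (\int[pri s a']_y (lik M (obs m qs w) s a' y * (beats a a' x y)%:R)%:E <=
   zof (obs m qs w) (s, a'))%E.
Proof.
apply: ge0_le_integral => //.
- by move=> y _; rewrite lee_fin mulr_ge0// ltW// lik_gt0.
- by apply/measurable_EFinP; exact: measurable_lik_beats.
- by apply/measurable_EFinP; exact: measurable_lik1.
by move=> y _; rewrite lee_fin ler_piMr// ?(ltW (lik_gt0 _ _ _ _))//; case: beats.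
Qed.

(** The cases [z = 0] and [z = +oo] are covered as well: [fine z] is then 0 and the quotient is 0 by
    convention. *)
Lemma fine_le_div (x z : \bar R) : (0 <= x)%E -> (x <= z)%E -> fine x / fine z <= 1.
Proof.
case: z => [z| |] x0 xz; last by have := le_trans x0 xz.
  have xf : x \is a fin_num by rewrite ge0_fin_numE// (le_lt_trans xz)// ltry.
  have [z0|z0] := eqVneq z 0; first by rewrite z0 invr0 mulr0.
  have z1 : 0 < z by rewrite lt_def z0 -lee_fin (le_trans x0).
  by rewrite ler_pdivrMr//= mul1r -lee_fin fineK.
by rewrite /= invr0 mulr0.
Qed.

Lemma post_le1 m qs w s a a' x : post M (obs m qs w) s a' (wins a a' x) <= 1.
Proof.
rewrite postE; apply: fine_le_div; last exact: lik_beats_le.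
by apply: integral_ge0 => y _; rewrite lee_fin mulr_ge0// ltW// lik_gt0.
Qed.

Definition postprod m qs w s a x : R :=
  \prod_(a' < K | a' != a) post M (obs m qs w) s a' (wins a a' x).

Lemma postprod_ge0 m qs w s a x : 0 <= postprod m qs w s a x.
Proof. by apply: prodr_ge0 => a' _; exact: post_ge0. Qed.

Lemma postprod_le1 m qs w s a x : postprod m qs w s a x <= 1.
Proof. by apply: prodr_ile1 => a' _; rewrite post_ge0 post_le1. Qed.

Lemma measurable_postprod d (U : measurableType d) (f : U -> Om) (g : U -> R) m qs s a :
  measurable_fun setT f -> measurable_fun setT g ->
  measurable_fun setT (fun u => postprod m qs (f u) s a (g u)).
Proof.
move=> mf mg; rewrite /postprod; under eq_fun do rewrite big_mkcond/=.
apply: measurable_prod => a' _; case: (a' != a); last exact: measurable_cst.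
exact: measurable_post.
Qed.

Lemma ts_prob_ge0 m qs w s a : 0 <= ts_prob M (obs m qs w) s a.
Proof.
rewrite ts_probE divr_ge0// fine_ge0 ?zof_ge0//; apply: integral_ge0 => x _.
by rewrite lee_fin mulr_ge0// ?postprod_ge0// ltW// lik_gt0.
Qed.

Lemma measurable_lik_postprod m qs w s a :
  measurable_fun setT
    (fun x => lik M (obs m qs w) s a x * postprod m qs w s a x).
Proof.
apply: measurable_funM; first exact: measurable_lik1.
exact: (measurable_postprod (f := cst w)).
Qed.

Lemma lik_postprod_le m qs w s a :
  (\int[pri s a]_x (lik M (obs m qs w) s a x * postprod m qs w s a x)%:E
    <= zof (obs m qs w) (s, a))%E.
Proof.
apply: ge0_le_integral => //.
- by move=> x _; rewrite lee_fin mulr_ge0// ?postprod_ge0// ltW// lik_gt0.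
- by apply/measurable_EFinP; exact: measurable_lik_postprod.
- by apply/measurable_EFinP; exact: measurable_lik1.
move=> x _; rewrite lee_fin ler_piMr// ?(ltW (lik_gt0 _ _ _ _))//.
exact: postprod_le1.
Qed.

Lemma ts_prob_le1 m qs w s a : ts_prob M (obs m qs w) s a <= 1.
Proof.
rewrite ts_probE; apply: fine_le_div; last exact: lik_postprod_le.
apply: integral_ge0 => x _.
by rewrite lee_fin mulr_ge0// ?postprod_ge0// ltW// lik_gt0.
Qed.

Lemma measurable_ts_prob d (U : measurableType d) (f : U -> Om) m qs s a :
  measurable_fun setT f ->
  measurable_fun setT (fun u => ts_prob M (obs m qs (f u)) s a).
Proof.
move=> mf; under eq_fun do rewrite ts_probE; apply: measurable_funM.
  apply: measurable_fine; apply: (measurable_integral_param (pri s a)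
    (f := fun q => lik M (obs m qs (f q.1)) s a q.2 * postprod m qs (f q.1) s a q.2)).
    have mf1 : measurable_fun setT (fun q : U * R => f q.1).
      exact: measurableT_comp mf measurable_fst.
    apply: measurable_funM.
      by apply: measurable_lik => //; exact: measurable_snd.
    by apply: measurable_postprod => //; exact: measurable_snd.
  by move=> q; rewrite mulr_ge0// ?postprod_ge0// ltW// lik_gt0.
apply: measurable_inv_ge0 => [u|]; first by rewrite fine_ge0// zof_ge0.
by apply: measurable_fine; exact: measurable_zof.
Qed.

(** All factors of [Zps] are positive, so a single infinite one would make the product infinite. *)
Lemma zof_fin ps w p : (Zps ps w < +oo)%E -> zof (obs 0 ps w) p \is a fin_num.
Proof.
rewrite ZpsE (bigD1 p)//= => zfin; rewrite ge0_fin_numE ?zof_ge0//.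
rewrite lt_neqAle leey andbT; apply/eqP => zp; move: zfin; rewrite zp gt0_mulye ?ltxx//.
by elim/big_rec: _ => // q y _ y0; rewrite mule_gt0// zof_gt0.
Qed.

(** Lets the competition inside one context be merged with the likelihood, which is a product over
    all pairs. *)
Lemma prod_context (s : S) (a : 'I_K) (g : 'I_K -> R) :
  \prod_(p : S * 'I_K | p != (s, a)) (if p.1 == s then g p.2 else 1) =
  \prod_(a' < K | a' != a) g a'.
Proof.
rewrite big_mkcond/=.
rewrite -(pair_bigA _ (fun s' a' => if (s', a') != (s, a) then
  if s' == s then g a' else 1 else 1))/=.
rewrite (bigD1 s)//= [X in _ * X]big1 ?mulr1 => [|s' ns]; last first.
  by rewrite big1// => a' _; rewrite (negPf ns); case: ifP.
rewrite [RHS]big_mkcond/=; apply: eq_bigr => a' _.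
by rewrite eqxx xpair_eqE eqxx.
Qed.

(** Probability matching: the law of the played arm is the posterior law of the optimal arm. Given
    the parameter [x] of [(s, a)], the other parameters are independent under the posterior, so the
    event that [a] wins has the product of posterior probabilities appearing in [ts_prob]. *)
Lemma ts_probP ps w s a : (Zps ps w < +oo)%E ->
  Qps ps s a w = ((ts_prob M (obs 0 ps w) s a)%:E * Zps ps w)%E.
Proof.
move=> Zfin; set h := obs 0 ps w; pose p0 := (s, a).
pose z p := fine (zof h p).
have zE p : zof h p = (z p)%:E by rewrite fineK// zof_fin.
have z0 p : z p != 0.
  by rewrite gt_eqF// -lte_fin -zE zof_gt0.
have nF : nnmeas (fun v : Om => (Lik (obs 0 ps v) (thof v) * opt s a (thof v))%:E).
  apply: nnmeas_EFin => [|v]; last by rewrite mulr_ge0 ?opt_ge0// ltW// Lik_gt0.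
  by apply: measurable_funM; [exact: measurable_Lik|exact: measurable_opt].
(* The coordinate of [(s, a)] becomes the outermost integral, because its value enters every
   comparison. *)
rewrite /Qps (ints_rem mI wI_meas wI_ge0 (i := inl p0) uniq_params)//; last first.
  by rewrite mem_params.
set l := rem _ _.
have lE : l = [seq i <- params | i != inl p0] by rewrite /l rem_filter ?uniq_params.
have ul : uniq l by rewrite lE filter_uniq// uniq_params.
have prodl (F : Idx -> \bar R) :
    (\prod_(i <- l) F i = \prod_(p | p != p0) F (inl p))%E.
  rewrite lE big_filter big_map big_enum_cond/=; apply: eq_bigl => p.
  by rewrite in_setT.
have inner x : ints l (fun v => (Lik (obs 0 ps v) (thof v) * opt s a (thof v))%:E)
    (setc w (inl p0) x) =
    ((\prod_(p | p != p0) z p) * (lik M h s a x * postprod 0 ps w s a x))%:E.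
  pose f (i : Idx) (y : R) : \bar R :=
    if i is inl p then (lik M h p.1 p.2 y *
      (if p.1 == s then (beats a p.2 x y)%:R else 1))%:E else 1%E.
  have f_ge0 i y : (0 <= f i y)%E.
    case: i => [p|n] //=; rewrite lee_fin mulr_ge0//; last by case: ifP.
    by rewrite ltW// lik_gt0.
  have f_meas i : measurable_fun setT (f i).
    case: i => [[s' a']|n]; last exact: measurable_cst.
    apply/measurable_EFinP => /=; case: (s' == s).
      exact: measurable_lik_beats.
    by under eq_fun do rewrite mulr1; exact: measurable_lik1.
  transitivity (ints l (fun v => (lik M h s a x)%:E * \prod_(i <- l) f i (v i))%E
     (setc w (inl p0) x)).
    apply: eq_ints => v hv.
    have vp : agree_off params v w.
      move=> i; rewrite mem_params; case: i => // n _.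
      by rewrite hv ?lE ?mem_filter ?mem_params ?andbF// setc_neq.
    have vx : v (inl p0) = x by rewrite hv ?setc_eq// lE mem_filter eqxx.
    rewrite (agree_params 0 ps vp) -/h prodl prodEFin -EFinM big_split/=.
    rewrite LikE (bigD1 p0)//= {1}/thof vx -!mulrA; congr ((_ * (_ * _))%:E).
      by apply: eq_bigr => -[].
    rewrite /opt; have /= <- := prod_context s a (fun a' =>
        (beats a a' (thof v s a) (thof v s a'))%:R).
    apply: eq_bigr => -[s' a'] _ /=; case: eqP => // ->.
    by rewrite /thof vx.
  rewrite intsZ; [|exact: wI_meas|exact: wI_ge0| |by rewrite lee_fin ltW// lik_gt0];
      last first.
    apply: nnmeas_prod => i _; split => [|v]; last exact: f_ge0.
    exact: measurableT_comp (f_meas i) (measurable_eval i).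
  rewrite ints_prod//; [|exact: wI_meas|exact: wI_ge0].
  rewrite prodl mulrCA [RHS]EFinM; congr (_ * _)%E.
  rewrite /postprod -/h -(prod_context s) -big_split/= -prodEFin.
  apply: eq_bigr => -[s' a'] _ /=; under eq_integral do rewrite mul1e.
  case: (eqVneq s' s) => [->|ns].
    rewrite postE -/(z (s, a')) mulrC divfK ?z0// fineK//.
    rewrite ge0_fin_numE; last first.
      by apply: integral_ge0 => y _; rewrite lee_fin mulr_ge0// ltW// lik_gt0.
    by apply: le_lt_trans (lik_beats_le _ _ _ _ _ _ _) _; rewrite -/h zE ltry.
  under eq_integral do rewrite mulr1.
  by rewrite mulr1 -zE.
rewrite /int1 /=; under eq_integral do rewrite mul1e inner EFinM.
have c0 : 0 <= \prod_(p | p != p0) z p.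
  by apply: prodr_ge0 => p _; rewrite fine_ge0// zof_ge0.
rewrite ge0_integralZl//; first last.
- by move=> x _; rewrite lee_fin mulr_ge0// ?postprod_ge0// ltW// lik_gt0.
- by apply/measurable_EFinP; exact: measurable_lik_postprod.
rewrite ts_probE ZpsE -/h; under [in RHS]eq_bigr do rewrite zE.
rewrite [in RHS]prodEFin [in RHS](bigD1 p0)//=. rewrite -EFinM mulrA -/(z (s, a)) divfK ?z0//.
rewrite mulrC EFinM fineK// ge0_fin_numE; last first.
  apply: integral_ge0 => x _.
  by rewrite lee_fin mulr_ge0// ?postprod_ge0// ltW// lik_gt0.
by apply: le_lt_trans (lik_postprod_le _ _ _ _ _) _; rewrite -/h zE ltry.
Qed.

(** * The integrals of the model as iterated coordinate integrals *)

Definition rwl (m k : nat) : seq Idx := map inr (iota m k).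

Lemma mem_rwl m k (i : Idx) :
  (i \in rwl m k) = (if i is inr n then (m <= n < m + k)%N else false).
Proof.
case: i => [p|n]; first by apply/negbTE/mapP => -[].
by rewrite mem_map ?mem_iota//; exact: inr_inj.
Qed.

Lemma uniq_rwl m k : uniq (rwl m k).
Proof. by rewrite map_inj_uniq ?iota_uniq//; exact: inr_inj. Qed.

Lemma agree_rwl_thof m k v w : agree_off (rwl m k) v w -> thof v = thof w.
Proof.
move=> h; apply/funext => s; apply/funext => a; apply: h.
by rewrite mem_rwl.
Qed.

Lemma agree_rwl_obs k ps v w :
  agree_off (rwl (size ps) k) v w -> obs 0 ps v = obs 0 ps w.
Proof.
move=> h; apply: eq_obs => i /andP[_ im]; apply: h.
by rewrite mem_rwl leqNgt -[X in (_ < X)%N]add0n im.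
Qed.

Lemma nnmeas_Lik m qs (f : Om -> R) : measurable_fun setT f -> (forall v, 0 <= f v) ->
  nnmeas (fun v => (Lik (obs m qs v) (thof v) * f v)%:E).
Proof.
move=> mf f0; apply: nnmeas_EFin => [|v]; last by rewrite mulr_ge0// ltW// Lik_gt0.
by apply: measurable_funM => //; exact: measurable_Lik.
Qed.

(** The bound [C] is carried through the induction: since each density has mass 1 it survives every
    integration, so each level is finite and its [fine] is harmless. *)
Lemma rw_intP qs m w (G : seq R -> R) (f : Om -> R) (C : R) :
  measurable_fun setT f -> (forall v, 0 <= f v <= C) ->
  (forall v, agree_off (rwl m (size qs)) v w -> G (rewards m (size qs) v) = f v) ->
  (rw_int M (thof w) qs G)%:E =
    ints (rwl m (size qs)) (fun v => (Lik (obs m qs v) (thof v) * f v)%:E) w /\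
  0 <= rw_int M (thof w) qs G <= C.
Proof.
move=> mf f0C; have f0 v : 0 <= f v by have /andP[] := f0C v.
elim: qs m w G => [|q qs ih] m w G hG.
  have {}hG : G [::] = f w by apply: (hG w).
  by rewrite /= /Lik big_nil mul1r hG.
pose l := rwl m.+1 (size qs).
pose H v := (Lik (obs m (q :: qs) v) (thof v) * f v)%:E.
pose rw x := rw_int M (thof w) qs (fun rs => G (x :: rs)).
have step x : (ell (thof w q.1 q.2) x * rw x)%:E = ints l H (setc w (inr m) x) /\
    0 <= rw x <= C.
  have [] := ih m.+1 (setc w (inr m) x) (fun rs => G (x :: rs)).
    move=> v hv; rewrite -hG; last exact: agree_off_setc hv.
    by rewrite -[rewards m _ v]/(v (inr m) :: rewards m.+1 (size qs) v) hv ?setc_eq//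
        mem_rwl ltnn.
  rewrite -/l -[thof (setc _ _ _)]/(thof w) -/(rw x) => e1 e2; split => //.
  rewrite EFinM e1 -intsZ; [|exact: wI_meas|exact: wI_ge0|exact: nnmeas_Lik|].
    apply: eq_ints => v hv; rewrite /H obs_cons /Lik big_cons/= -EFinM mulrA.
    congr (_ * _ * _)%:E; rewrite hv ?setc_eq//; last by rewrite mem_rwl ltnn.
    by rewrite (agree_rwl_thof hv).
  by rewrite lee_fin ltW// ell_gt0.
have nH : nnmeas H by exact: nnmeas_Lik.
have [mI1 I0] := nnmeas_integrand wI_meas wI_ge0 (inr m) w (nnmeas_ints mI wI_meas wI_ge0
    l nH).
have intE : ints (rwl m (size (q :: qs))) H w =
    (\int[nu0]_x ((b x)%:E * (ell (thof w q.1 q.2) x * rw x)%:E))%E.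
  by apply: eq_integral => x _; rewrite (step x).1.
have fE : (fun x => (wI (inr m) x)%:E * ints l H (setc w (inr m) x))%E =
    (fun x => (b x)%:E * (ell (thof w q.1 q.2) x * rw x)%:E)%E.
  by apply/funext => x; rewrite (step x).1.
rewrite -/l fE in mI1.
have iC : (ints (rwl m (size (q :: qs))) H w <= C%:E)%E.
  rewrite intE -[leRHS]mule1 -(dens1 (thof w q.1 q.2)) -ge0_integralZl//; last 3 first.
  - apply/measurable_EFinP; apply: measurable_funM => //; exact: measurable_ell.
  - by move=> x _; rewrite lee_fin mulr_ge0// ltW// ell_gt0.
  - by have /andP[h1 h2] := f0C w; rewrite lee_fin (le_trans h1).
  apply: ge0_le_integral => //.
  - move=> x _; rewrite -EFinM lee_fin !mulr_ge0 ?(ltW (ell_gt0 _ _))//.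
    by have /andP[] := (step x).2.
  - apply: emeasurable_funM => //; apply/measurable_EFinP.
    by apply: measurable_funM => //; exact: measurable_ell.
  move=> x _; rewrite -!EFinM lee_fin mulrA mulrC.
  have /andP[_ h] := (step x).2.
  by rewrite ler_wpM2r// mulr_ge0// ltW// ell_gt0.
have i0 : (0 <= ints (rwl m (size (q :: qs))) H w)%E.
  by apply: ints_ge0 => //; [exact: wI_meas|exact: wI_ge0].
have rE : rw_int M (thof w) (q :: qs) G = fine (ints (rwl m (size (q :: qs))) H w).
  rewrite intE -integral_b /=; congr fine; apply: eq_integral => x _.
  by rewrite mulrA.
have ifin : ints (rwl m (size (q :: qs))) H w \is a fin_num.
  by rewrite ge0_fin_numE// (le_lt_trans iC)// ltry.
by split; rewrite rE ?fineK// -!lee_fin fineK// i0.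
Qed.

Lemma prior_intP (l : seq (S * 'I_K)) w (F : instance R S K -> R) (f : Om -> R) (C : R) :
  measurable_fun setT f -> (forall v, 0 <= f v <= C) ->
  (forall v, agree_off (map inl l) v w -> F (thof v) = f v) ->
  (prior_int M l F (thof w))%:E = ints (map inl l) (EFin \o f) w /\
  0 <= prior_int M l F (thof w) <= C.
Proof.
move=> mf f0C; have f0 v : 0 <= f v by have /andP[] := f0C v.
elim: l w => [|p l ih] w hF; first by rewrite /= hF.
have thE x : upd (thof w) p x = thof (setc w (inl p) x).
  apply/funext => s; apply/funext => a.
  by rewrite /upd /thof /setc -xpair_eqE -surjective_pairing.
have step x : (prior_int M l F (upd (thof w) p x))%:E =
    ints (map inl l) (EFin \o f) (setc w (inl p) x) /\
    0 <= prior_int M l F (upd (thof w) p x) <= C.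
  by rewrite thE; apply: ih => v /agree_off_setc; exact: hF.
have nf : nnmeas (EFin \o f) by exact: nnmeas_EFin.
have [mI1 I0] := nnmeas_integrand wI_meas wI_ge0 (inl p) w
  (nnmeas_ints mI wI_meas wI_ge0 (map inl l) nf).
have intE : ints (map inl (p :: l)) (EFin \o f) w =
    (\int[pri p.1 p.2]_x (prior_int M l F (upd (thof w) p x))%:E)%E.
  by apply: eq_integral => x _; rewrite (step x).1 mul1e.
have fE : (fun x => (wI (inl p) x)%:E *
      ints (map inl l) (EFin \o f) (setc w (inl p) x))%E =
    (fun x => (prior_int M l F (upd (thof w) p x))%:E).
  by apply/funext => x; rewrite (step x).1 mul1e.
rewrite fE in mI1.
have iC : (ints (map inl (p :: l)) (EFin \o f) w <= C%:E)%E.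
  have -> : C%:E = (\int[pri p.1 p.2]_x (cst C%:E x))%E.
    by rewrite integral_cst//= probability_setT mule1.
  rewrite intE; apply: ge0_le_integral => //.
    by move=> x _; rewrite lee_fin; have /andP[] := (step x).2.
  by move=> x _; rewrite lee_fin; have /andP[] := (step x).2.
have i0 : (0 <= ints (map inl (p :: l)) (EFin \o f) w)%E.
  by apply: ints_ge0 => //; [exact: wI_meas|exact: wI_ge0].
have ifin : ints (map inl (p :: l)) (EFin \o f) w \is a fin_num.
  by rewrite ge0_fin_numE// (le_lt_trans iC)// ltry.
have rE : prior_int M (p :: l) F (thof w) = fine (ints (map inl (p :: l)) (EFin \o f) w).
  by rewrite intE.
by split; rewrite rE ?fineK// -!lee_fin fineK// i0.
Qed.

(** * The regret recursion on coordinates *)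

Variable N : nat.
Hypothesis K_gt0 : (0 < K)%N.
Hypothesis PS_ge0 : forall s, 0 <= PSw s.
Hypothesis PS_sum : \sum_s PSw s = 1.

Definition regr (j : nat) (ps : seq (S * 'I_K)) (w : Om) : R :=
  ts_regret M N (thof w) j (obs 0 ps w).

Definition gap (c : {ffun 'I_N -> S}) (acts : {ffun 'I_N -> 'I_K})
    (t : instance R S K) : R :=
  \sum_(n < N) (mustar M t (c n) - mean_of M (t (c n) (acts n))).

Definition actw ps (c : {ffun 'I_N -> S}) (acts : {ffun 'I_N -> 'I_K}) w : R :=
  \prod_(n < N) ts_prob M (obs 0 ps w) (c n) (acts n).

Definition ctxw (c : {ffun 'I_N -> S}) : R := \prod_(n < N) PSw (c n).

Definition future j ps qs (w : Om) : \bar R :=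
  ints (rwl (size ps) (size qs))
    (fun v => (Lik (obs (size ps) qs v) (thof v) * regr j (ps ++ qs) v)%:E) w.

Lemma gap_ge0 c acts t : 0 <= gap c acts t.
Proof. by apply: sumr_ge0 => n _; rewrite subr_ge0 mustar_ge. Qed.

Lemma gap_le c acts t : gap c acts t <= N%:R.
Proof.
rewrite -[N in leRHS]card_ord -sumr_const; apply: ler_sum => n _.
by rewrite lerBlDr ler_wpDr ?mean_ge0// mustar_le1.
Qed.

Lemma measurable_gap c acts : measurable_fun setT (fun w : Om => gap c acts (thof w)).
Proof.
apply: measurable_sum => n; apply: measurable_funB; first exact: measurable_mustar.
by apply: measurableT_comp measurable_mean _; exact: measurable_thof.
Qed.

Lemma actw_ge0 ps c acts w : 0 <= actw ps c acts w.
Proof. by apply: prodr_ge0 => n _; exact: ts_prob_ge0. Qed.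

Lemma actw_le1 ps c acts w : actw ps c acts w <= 1.
Proof. by apply: prodr_ile1 => n _; rewrite ts_prob_ge0 ts_prob_le1. Qed.

Lemma measurable_actw ps c acts : measurable_fun setT (actw ps c acts).
Proof. by apply: measurable_prod => n _; exact: measurable_ts_prob. Qed.

Lemma ctxw_ge0 c : 0 <= ctxw c.
Proof. by apply: prodr_ge0. Qed.

(** Measurability, boundedness and the recursion are proved together, since rewriting [rw_int] in
    one more round needs the first two for the remaining rounds. Of [C] only the existence
    matters. *)
Lemma regr_spec j : exists2 C, 0 <= C & forall ps,
  [/\ measurable_fun setT (regr j ps), forall w, 0 <= regr j ps w <= C &
   forall w, (if j is j'.+1 then regr j ps w = \sum_c ctxw c *
      \sum_acts actw ps c acts w *
        (gap c acts (thof w) + fine (future j' ps (pulls c acts) w)) /\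
        (forall (c : {ffun 'I_N -> S}) (acts : {ffun 'I_N -> 'I_K}),
           future j' ps (pulls c acts) w \is a fin_num)
      else regr j ps w = 0)].
Proof.
elim: j => [|j [C C0 ih]].
  exists 0 => // ps; split => //; first exact: measurable_cst.
  by move=> w; rewrite /regr lexx.
have rw ps (c : {ffun 'I_N -> S}) (acts : {ffun 'I_N -> 'I_K}) w :
    let: r := rw_int M (thof w) (pulls c acts)
      (fun rs => ts_regret M N (thof w) j (obs 0 ps w ++ zip (pulls c acts) rs)) in
    r%:E = future j ps (pulls c acts) w /\ 0 <= r <= C.
  have [mr r0C _] := ih (ps ++ pulls c acts).
  apply: rw_intP => // v hv; rewrite /regr obs_cat add0n.
  by rewrite (agree_rwl_thof hv) (agree_rwl_obs hv).
have ffin ps (c : {ffun 'I_N -> S}) (acts : {ffun 'I_N -> 'I_K}) w :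
    future j ps (pulls c acts) w \is a fin_num.
  by rewrite -(rw ps c acts w).1.
have f0 ps (c : {ffun 'I_N -> S}) (acts : {ffun 'I_N -> 'I_K}) w :
    0 <= fine (future j ps (pulls c acts) w) <= C.
  by have [<-] := rw ps c acts w.
have regrE ps w : regr j.+1 ps w = \sum_c ctxw c *
      \sum_acts actw ps c acts w *
        (gap c acts (thof w) + fine (future j ps (pulls c acts) w)).
  rewrite /regr /=; apply: eq_bigr => c _; congr (_ * _).
  apply: eq_bigr => acts _; congr (_ * (_ + _)).
  by rewrite -(rw ps c acts w).1.
(* At this stage the weights [actw] are only known to be at most 1 each, so the bound counts every
   choice of arms fully. *)
exists (\sum_c ctxw c * \sum_(acts : {ffun 'I_N -> 'I_K}) (N%:R + C)).
  by apply: sumr_ge0 => c _; rewrite mulr_ge0 ?ctxw_ge0// sumr_ge0// => a _; rewrite addr_ge0.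
move=> ps; split.
- have -> : regr j.+1 ps = fun w => \sum_c ctxw c * \sum_acts actw ps c acts w *
      (gap c acts (thof w) + fine (future j ps (pulls c acts) w)).
    by apply/funext => w; exact: regrE.
  apply: measurable_sum => c; apply: measurable_funM => //.
  apply: measurable_sum => acts; apply: measurable_funM; first exact: measurable_actw.
  apply: measurable_funD; first exact: measurable_gap.
  apply: measurable_fine; apply: (nnmeas_ints mI wI_meas wI_ge0 _ _).1.
  have [mr r0C _] := ih (ps ++ pulls c acts).
  by apply: nnmeas_Lik => // v; have /andP[] := r0C v.
- move=> w; rewrite regrE; apply/andP; split.
    apply: sumr_ge0 => c _; rewrite mulr_ge0 ?ctxw_ge0// sumr_ge0// => a _.
    rewrite mulr_ge0 ?actw_ge0// addr_ge0 ?gap_ge0//.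
    by have /andP[] := f0 ps c a w.
  apply: ler_sum => c _; apply: ler_wpM2l; first exact: ctxw_ge0.
  apply: ler_sum => a _; have /andP[h1 h2] := f0 ps c a w.
  rewrite -[leRHS]mul1r; apply: ler_pM; rewrite ?actw_ge0 ?actw_le1 ?addr_ge0 ?gap_ge0//.
  by rewrite lerD// gap_le.
- by move=> w; split => [|c a]; [exact: regrE|exact: ffin].
Qed.

(** * Unnormalised posterior expectations and their tower property *)

Definition expP (ps : seq (S * 'I_K)) (g : Om -> R) (w : Om) : \bar R :=
  ints params (fun v => (Lik (obs 0 ps v) (thof v) * g v)%:E) w.

Lemma expP_ge0 ps (g : Om -> R) w : measurable_fun setT g -> (forall v, 0 <= g v) ->
  (0 <= expP ps g w)%E.
Proof.
by move=> mg g0; apply: ints_ge0; [exact: wI_meas|exact: wI_ge0|exact: nnmeas_Lik].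
Qed.

Lemma nnmeas_expP ps (g : Om -> R) : measurable_fun setT g -> (forall v, 0 <= g v) ->
  nnmeas (expP ps g).
Proof.
by move=> mg g0; apply: nnmeas_ints; [exact: wI_meas|exact: wI_ge0|exact: nnmeas_Lik].
Qed.

Lemma ZpsP ps w : Zps ps w = expP ps (cst 1) w.
Proof. by apply: eq_ints => v _; rewrite mulr1. Qed.

Lemma expPD ps (g g' : Om -> R) w : measurable_fun setT g -> (forall v, 0 <= g v) ->
  measurable_fun setT g' -> (forall v, 0 <= g' v) ->
  expP ps (fun v => g v + g' v) w = (expP ps g w + expP ps g' w)%E.
Proof.
move=> mg g0 mg' g0'; rewrite /expP -intsD;
    [|exact: wI_meas|exact: wI_ge0|exact: nnmeas_Lik|exact: nnmeas_Lik].
by apply: eq_ints => v _; rewrite mulrDr.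
Qed.

Lemma expP_sum ps J (r : seq J) (g : J -> Om -> R) w :
  (forall i, measurable_fun setT (g i)) -> (forall i v, 0 <= g i v) ->
  expP ps (fun v => \sum_(i <- r) g i v) w = (\sum_(i <- r) expP ps (g i) w)%E.
Proof.
move=> mg g0; rewrite /expP -ints_sum; [|exact: wI_meas|exact: wI_ge0|by move=> i;
    exact: nnmeas_Lik].
by apply: eq_ints => v _; rewrite mulr_sumr sumEFin.
Qed.

Lemma le_expP ps (g g' : Om -> R) w : measurable_fun setT g -> (forall v, 0 <= g v) ->
  measurable_fun setT g' -> (forall v, g v <= g' v) ->
  (expP ps g w <= expP ps g' w)%E.
Proof.
move=> mg g0 mg' gg'; have g0' v : 0 <= g' v := le_trans (g0 v) (gg' v).
apply: le_ints;
  [exact: wI_meas|exact: wI_ge0|exact: uniq_params|exact: nnmeas_Lik|exact: nnmeas_Lik|].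
by move=> v _ _; rewrite lee_fin ler_wpM2l// ltW// Lik_gt0.
Qed.

Lemma expP_Zr ps (g h : Om -> R) w : measurable_fun setT g -> (forall v, 0 <= g v) ->
  0 <= h w -> (forall v, agree_off params v w -> h v = h w) ->
  expP ps (fun v => h v * g v) w = ((h w)%:E * expP ps g w)%E.
Proof.
move=> mg g0 h0 hh; rewrite -intsZ;
    [|exact: wI_meas|exact: wI_ge0|exact: nnmeas_Lik|by rewrite lee_fin].
by apply: eq_ints => v /hh ->; rewrite -EFinM mulrCA.
Qed.

Lemma nnmeas_Lik1 m qs : nnmeas (fun u : Om => (Lik (obs m qs u) (thof u))%:E).
Proof. by apply: nnmeas_EFin => [|v]; [exact: measurable_Lik|rewrite ltW ?Lik_gt0]. Qed.

Lemma ints_Lik_cons m q qs (f : Om -> R) w x :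
  measurable_fun setT f -> (forall v, 0 <= f v) ->
  ints (rwl m.+1 (size qs)) (fun u => (Lik (obs m (q :: qs) u) (thof u) * f u)%:E)
    (setc w (inr m) x) =
  ((ell (thof w q.1 q.2) x)%:E *
    ints (rwl m.+1 (size qs)) (fun u => (Lik (obs m.+1 qs u) (thof u) * f u)%:E)
      (setc w (inr m) x))%E.
Proof.
move=> mf f0; rewrite -intsZ;
    [|exact: wI_meas|exact: wI_ge0|exact: nnmeas_Lik|by rewrite lee_fin ltW ?ell_gt0].
apply: eq_ints => v hv; rewrite obs_cons /Lik big_cons/= -EFinM mulrA.
congr (_ * _ * _)%:E; rewrite hv ?setc_eq//; last by rewrite mem_rwl ltnn.
by rewrite (agree_rwl_thof hv).
Qed.

Lemma ints_rwl_cons m k (F : Om -> \bar R) w :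
  ints (rwl m k.+1) F w =
  (\int[nu0]_x ((b x)%:E * ints (rwl m.+1 k) F (setc w (inr m) x)))%E.
Proof. by []. Qed.

Lemma ints_Lik1 m qs w :
  ints (rwl m (size qs)) (fun u => (Lik (obs m qs u) (thof u) * 1)%:E) w = 1%E.
Proof.
elim: qs m w => [|q qs ih] m w; first by rewrite /= /Lik big_nil mulr1.
rewrite ints_rwl_cons -(dens1 (thof w q.1 q.2)).
by apply: eq_integral => x _; rewrite ints_Lik_cons// ih mule1 EFinM.
Qed.

(** Only the reward of pull [n] enters [rho]; the other rewards integrate to 1. *)
Lemma ints_Lik_rho m qs n (q0 : S * 'I_K) (rho kr : R -> R) w : (n < size qs)%N ->
  measurable_fun setT rho -> (forall x, 0 <= rho x) ->
  (forall x, kap rho x = (kr x)%:E) ->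
  ints (rwl m (size qs))
    (fun u => (Lik (obs m qs u) (thof u) * rho (u (inr (m + n)%N)))%:E) w =
  (kr (thof w (nth q0 qs n).1 (nth q0 qs n).2))%:E.
Proof.
move=> + mr r0 hk; have mf k : measurable_fun setT (fun u : Om => rho (u (inr k))).
  exact: measurableT_comp mr (measurable_eval _).
elim: qs n m w => [//|q qs ih] [|n] m w nq.
  rewrite ints_rwl_cons -hk; apply: eq_integral => x _.
  rewrite ints_Lik_cons// EFinM; congr (_ * (_ * _))%E; rewrite addn0.
  transitivity (ints (rwl m.+1 (size qs))
     (fun u => (rho x)%:E * (Lik (obs m.+1 qs u) (thof u) * 1)%:E)%E (setc w (inr m) x)).
    apply: eq_ints => u hu; rewrite -EFinM mulr1 mulrC hu ?setc_eq//.
    by rewrite mem_rwl ltnn.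
  rewrite intsZ; [|exact: wI_meas|exact: wI_ge0|exact: nnmeas_Lik|by rewrite lee_fin].
  by rewrite ints_Lik1 mule1.
rewrite ints_rwl_cons /= -[RHS]mule1 -(dens1 (thof w q.1 q.2)) -ge0_integralZl//; last 3 first.
- apply/measurable_EFinP; apply: measurable_funM => //; exact: measurable_ell.
- by move=> x _; rewrite lee_fin mulr_ge0// ltW// ell_gt0.
- rewrite -hk; apply: integral_ge0 => x _.
  by rewrite mule_ge0// lee_fin ?b_ge0// mulr_ge0// ltW// ell_gt0.
apply: eq_integral => x _; rewrite ints_Lik_cons//.
under eq_ints do rewrite addnS -addSn.
rewrite ih// -[thof (setc _ _ _)]/(thof w) muleA muleC; congr (_ * _)%E.
Qed.

Lemma disj_rwl_params m k i : i \in rwl m k -> i \notin params.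
Proof. by rewrite mem_rwl mem_params; case: i. Qed.

Lemma Lik_cat_agree ps qs v :
  Lik (obs 0 (ps ++ qs) v) (thof v) =
  Lik (obs 0 ps v) (thof v) * Lik (obs (size ps) qs v) (thof v).
Proof. by rewrite obs_cat add0n Lik_cat. Qed.

(** Bayes' rule without division: the integrals over new rewards and over parameters commute, and
    the likelihood of the old observations does not involve the new rewards. *)
Lemma expP_swap ps qs (f : Om -> R) w :
  measurable_fun setT f -> (forall v, 0 <= f v) ->
  ints (rwl (size ps) (size qs)) (expP (ps ++ qs) f) w =
  ints params (fun v => (Lik (obs 0 ps v) (thof v))%:E *
    ints (rwl (size ps) (size qs))
      (fun u => (Lik (obs (size ps) qs u) (thof u) * f u)%:E) v)%E w.
Proof.
move=> mf f0; rewrite /expP intsC; last 4 first.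
- exact: wI_meas.
- exact: wI_ge0.
- by move=> i; exact: disj_rwl_params.
- exact: nnmeas_Lik.
apply: eq_ints => v _.
transitivity (ints (rwl (size ps) (size qs)) (fun u => (Lik (obs 0 ps u) (thof u))%:E *
   (Lik (obs (size ps) qs u) (thof u) * f u)%:E)%E v).
  by apply: eq_ints => u _; rewrite Lik_cat_agree -EFinM mulrA.
apply: (intsZ_indep mI wI_meas wI_ge0 (C := fun u => (Lik (obs 0 ps u) (thof u))%:E)).
- exact: nnmeas_Lik.
- by move=> u; rewrite lee_fin ltW ?Lik_gt0.
- by move=> u hu; rewrite (agree_rwl_thof hu) (agree_rwl_obs hu).
Qed.

(** Tower property: averaged over the round, the next posterior returns the present one, and a
    function of reward [n] turns into its expectation given the parameter of the pulled pair. *)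
Lemma transport ps qs n (q0 : S * 'I_K) (rho kr : R -> R)
    (g : instance R S K -> R) w : (n < size qs)%N ->
  measurable_fun setT rho -> (forall x, 0 <= rho x) ->
  (forall x, kap rho x = (kr x)%:E) ->
  measurable_fun setT (fun v : Om => g (thof v)) -> (forall t, 0 <= g t) ->
  ints (rwl (size ps) (size qs))
    (fun v => (rho (v (inr (size ps + n)%N)))%:E * expP (ps ++ qs) (g \o thof) v)%E w =
  expP ps (fun v => g (thof v) * kr (thof v (nth q0 qs n).1 (nth q0 qs n).2)) w.
Proof.
move=> nq mr r0 hk mg g0.
have mf k : measurable_fun setT (fun u : Om => rho (u (inr k))).
  exact: measurableT_comp mr (measurable_eval _).
transitivity (ints (rwl (size ps) (size qs)) (expP (ps ++ qs)
   (fun v => rho (v (inr (size ps + n)%N)) * g (thof v))) w).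
  apply: eq_ints => v _; rewrite expP_Zr// => u hu.
  by rewrite hu// mem_params.
rewrite expP_swap; [|by apply: measurable_funM|by move=> v; rewrite mulr_ge0].
apply: eq_ints => v _; rewrite EFinM; congr (_ * _)%E.
rewrite [RHS]EFinM -(ints_Lik_rho (size ps) q0 v nq mr r0 hk) -intsZ; last 4 first.
- exact: wI_meas.
- exact: wI_ge0.
- by apply: nnmeas_Lik => // u; exact: r0.
- by rewrite lee_fin.
apply: eq_ints => u hu; rewrite -EFinM mulrA mulrC.
by rewrite (agree_rwl_thof hu).
Qed.

Definition Vps j ps (w : Om) : \bar R := expP ps (regr j ps) w.

Lemma Vps0 ps w : Vps 0 ps w = 0%E.
Proof.
rewrite /Vps /expP -(ints0 mI wI params w); apply: eq_ints => v _.
by rewrite /regr /= mulr0.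
Qed.

(** A dynamic programming recursion. The weights of contexts and arms depend on the history alone,
    so they leave the integral over parameters; [expP_swap] handles the later rounds. *)
Lemma VpsS j ps w : Vps j.+1 ps w =
  (\sum_c \sum_(acts : {ffun 'I_N -> 'I_K})
    (ctxw c * actw ps c acts w)%:E *
    (expP ps (fun v => gap c acts (thof v)) w +
     ints (rwl (size ps) (size (pulls c acts))) (Vps j (ps ++ pulls c acts)) w))%E.
Proof.
have [C C0 hj] := regr_spec j; have [C' C'0 hS] := regr_spec j.+1.
have [_ _ hSw] := hS ps.
have nreg qs : nnmeas (fun u => (Lik (obs (size ps) qs u) (thof u) * regr j (ps ++ qs) u)%:E).
  have [mr r0C _] := hj (ps ++ qs); apply: nnmeas_Lik => // v.
  by have /andP[] := r0C v.
have nfut qs : nnmeas (future j ps qs).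
  by apply: nnmeas_ints; [exact: wI_meas|exact: wI_ge0|exact: nreg].
have nA (c : {ffun 'I_N -> S}) (acts : {ffun 'I_N -> 'I_K}) :
    nnmeas (fun v => (Lik (obs 0 ps v) (thof v) * gap c acts (thof v))%:E +
      (Lik (obs 0 ps v) (thof v))%:E * future j ps (pulls c acts) v)%E.
  apply: nnmeasD; first by apply: nnmeas_Lik => [|v]; [exact: measurable_gap|exact: gap_ge0].
  by apply: nnmeasM => //; exact: nnmeas_Lik1.
have cw0 c acts v : 0 <= ctxw c * actw ps c acts v.
  by rewrite mulr_ge0 ?ctxw_ge0 ?actw_ge0.
transitivity (ints params (fun v => \sum_c \sum_(acts : {ffun 'I_N -> 'I_K})
    (ctxw c * actw ps c acts v)%:E *
    ((Lik (obs 0 ps v) (thof v) * gap c acts (thof v))%:E +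
      (Lik (obs 0 ps v) (thof v))%:E * future j ps (pulls c acts) v))%E w).
  apply: eq_ints => v _; have [-> ffin] := hSw v.
  rewrite mulr_sumr -sumEFin; apply: eq_bigr => c _.
  rewrite !mulr_sumr -sumEFin; apply: eq_bigr => acts _.
  rewrite -(fineK (ffin c acts)) -!EFinM; congr EFin.
  by rewrite /=; ring.
have ncw c acts : nnmeas (fun v : Om => (ctxw c * actw ps c acts v)%:E).
  by apply: nnmeas_EFin => //; apply: measurable_funM => //; exact: measurable_actw.
rewrite ints_sum; [|exact: wI_meas|exact: wI_ge0|]; last first.
  by move=> c; apply: nnmeas_sum => acts; exact: nnmeasM.
apply: eq_bigr => c _; rewrite ints_sum; [|exact: wI_meas|exact: wI_ge0|]; last first.
  by move=> acts; exact: nnmeasM.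
apply: eq_bigr => acts _.
rewrite (intsZ_indep mI wI_meas wI_ge0 (C := fun v => (ctxw c * actw ps c acts v)%:E));
    last 3 first.
- exact: nA.
- by move=> v; rewrite lee_fin.
- move=> v hv; congr (_ * _)%:E; apply: eq_bigr => n _.
  by rewrite (agree_params 0 ps hv).
congr (_ * _)%E.
rewrite intsD; [|exact: wI_meas|exact: wI_ge0| |]; last 2 first.
- by apply: nnmeas_Lik => [|v]; [exact: measurable_gap|exact: gap_ge0].
- by apply: nnmeasM => //; exact: nnmeas_Lik1.
have [mr r0C _] := hj (ps ++ pulls c acts).
by rewrite [in RHS]/Vps expP_swap// => v; have /andP[] := r0C v.
Qed.

Lemma expP_fin ps (g : Om -> R) w : (Zps ps w < +oo)%E ->
  measurable_fun setT g -> (forall v, 0 <= g v <= 1) ->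
  expP ps g w = (fine (expP ps g w))%:E /\
  0 <= fine (expP ps g w) <= fine (Zps ps w).
Proof.
move=> Zf mg g01; have g0 v : 0 <= g v by have /andP[] := g01 v.
have e0 := expP_ge0 ps w mg g0.
have eZ : (expP ps g w <= Zps ps w)%E.
  by rewrite ZpsP; apply: le_expP => // v; have /andP[] := g01 v.
have ef : expP ps g w \is a fin_num by rewrite ge0_fin_numE// (le_lt_trans eZ).
have Zfin : Zps ps w \is a fin_num by rewrite ge0_fin_numE// (le_trans e0).
by split; rewrite ?fineK// fine_ge0//= fine_le.
Qed.

Lemma Zps_gt0 ps w : (0 < Zps ps w)%E.
Proof.
by rewrite ZpsE; elim/big_ind: _ => // [x y|p _]; [exact: mule_gt0|exact: zof_gt0].
Qed.

Lemma Zps_fin ps w : (Zps ps w < +oo)%E ->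
  Zps ps w = (fine (Zps ps w))%:E /\ 0 < fine (Zps ps w).
Proof.
move=> Zf; have z0 := Zps_gt0 ps w.
by rewrite fineK ?ge0_fin_numE ?(ltW z0)//; split => //; rewrite fine_gt0// z0.
Qed.

Lemma measurable_opt1 s a : measurable_fun setT (fun v : Om => opt s a (thof v)).
Proof. exact: measurable_opt. Qed.

Lemma QpsP ps s a w : Qps ps s a w = expP ps (fun v => opt s a (thof v)) w.
Proof. by []. Qed.

Lemma Qps_fin ps s a w : (Zps ps w < +oo)%E ->
  Qps ps s a w = (fine (Qps ps s a w))%:E /\
  0 <= fine (Qps ps s a w) <= fine (Zps ps w).
Proof.
move=> Zf; apply: expP_fin => //; first exact: measurable_opt1.
by move=> v; rewrite opt_ge0 opt_le1.
Qed.

Lemma nnmeas_Qps ps s a : nnmeas (Qps ps s a).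
Proof. by apply: nnmeas_expP => [|v]; [exact: measurable_opt1|exact: opt_ge0]. Qed.

Lemma nnmeas_Zps ps : nnmeas (Zps ps).
Proof. by apply: nnmeas_ints; [exact: wI_meas|exact: wI_ge0|exact: nnmeas_Lik1]. Qed.

(* This is [0] where [Zps] is infinite, because [fine +oo = 0]. *)
Definition Hps ps s o (w : Om) : R := ent (fine (Qps ps s o w)) (fine (Zps ps w)).

Lemma Hps_ge0 ps s o w : 0 <= Hps ps s o w.
Proof.
rewrite /Hps; have [Zf|] := ltP (Zps ps w) +oo%E.
  by have [_ /andP[h1 h2]] := Qps_fin s o Zf; exact: ent_ge0.
by rewrite leye_eq => /eqP ->; rewrite /ent /= mul0r ln0// mulr0.
Qed.

Lemma nnmeas_Hps ps s o : nnmeas (fun v => (Hps ps s o v)%:E).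
Proof.
apply: nnmeas_EFin => [|v]; last exact: Hps_ge0.
have mQ : measurable_fun setT (fun v => fine (Qps ps s o v)).
  by apply: measurable_fine; exact: (nnmeas_Qps ps s o).1.
apply: measurable_funM => //; apply: measurableT_comp; first exact: measurable_ln.
apply: measurable_funM; first by apply: measurable_fine; exact: (nnmeas_Zps ps).1.
apply: measurable_inv_ge0 => // v; apply: fine_ge0; exact: (nnmeas_Qps ps s o).2.
Qed.

Definition EHps ps qs s o (w : Om) : \bar R :=
  ints (rwl (size ps) (size qs)) (fun v => (Hps (ps ++ qs) s o v)%:E) w.

Definition meanP ps s a (w : Om) : R :=
  fine (expP ps (fun v => mean_of M (thof v s a)) w).

(** Up to normalisation, the posterior probability that [o] is optimal in [s'] times the conditional
    mean of [(s, a)] given this event. *)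
Definition mean_optP ps s a s' o (w : Om) : R :=
  fine (expP ps (fun v => opt s' o (thof v) * mean_of M (thof v s a)) w).

Lemma measurable_mean1 s a : measurable_fun setT (fun v : Om => mean_of M (thof v s a)).
Proof. by apply: measurableT_comp measurable_mean _; exact: measurable_thof. Qed.

Lemma meanP_fin ps s a w : (Zps ps w < +oo)%E ->
  expP ps (fun v => mean_of M (thof v s a)) w = (meanP ps s a w)%:E /\
  0 <= meanP ps s a w <= fine (Zps ps w).
Proof.
move=> Zf; apply: expP_fin => //; first exact: measurable_mean1.
by move=> v; rewrite mean_ge0 mean_le1.
Qed.

Lemma mean_optP_fin ps s a s' o w : (Zps ps w < +oo)%E ->
  expP ps (fun v => opt s' o (thof v) * mean_of M (thof v s a)) w =
    (mean_optP ps s a s' o w)%:E /\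
  0 <= mean_optP ps s a s' o w <= fine (Qps ps s' o w).
Proof.
move=> Zf.
have mo : measurable_fun setT (fun v : Om => opt s' o (thof v) * mean_of M (thof v s a)).
  by apply: measurable_funM; [exact: measurable_opt1|exact: measurable_mean1].
have o0 v : 0 <= opt s' o (thof v) * mean_of M (thof v s a).
  by rewrite mulr_ge0 ?opt_ge0 ?mean_ge0.
have ole v : opt s' o (thof v) * mean_of M (thof v s a) <= opt s' o (thof v).
  by rewrite ler_piMr ?opt_ge0 ?mean_le1.
have [|e1 /andP[e2 _]] := expP_fin Zf mo.
  by move=> v; rewrite o0 (le_trans (ole v)) ?opt_le1.
split => //; rewrite e2 -lee_fin -e1 -(Qps_fin _ _ Zf).1 QpsP.
by apply: le_expP => //; exact: measurable_opt1.
Qed.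

Lemma transport1 ps qs n (g : instance R S K -> R) w : (n < size qs)%N ->
  measurable_fun setT (fun v : Om => g (thof v)) -> (forall t, 0 <= g t) ->
  ints (rwl (size ps) (size qs)) (expP (ps ++ qs) (g \o thof)) w =
  expP ps (fun v => g (thof v)) w.
Proof.
case: qs => // q0 qs nq mg g0.
have := @transport ps (q0 :: qs) n q0 (cst 1) (cst 1) g w nq.
move=> /(_ (@measurable_cst _ _ _ _ _ _) (fun=> ler01) kap1 mg g0) h.
transitivity (expP ps (fun v => g (thof v) * 1) w).
  by rewrite -h; apply: eq_ints => v _; rewrite mul1e.
by apply: eq_ints => v _; rewrite mulr1.
Qed.

(** * The entropy inequality integrated over a round *)

(** [ent_fenchel] is applied to the posterior after the round, with [r] the reward of pull [n] and
    [m] the present posterior mean of the pulled pair, and integrated over all rewards of the round.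
    The tower property evaluates every integral except that of the entropy. By the choice of [m] the
    terms [z * eps * t * m] and [eps * t * m0] cancel. *)
Lemma key_ineq ps qs n q0 s o w eps t : (Zps ps w < +oo)%E -> (n < size qs)%N ->
  0 < eps <= 1 -> 0 <= t <= 2^-1 ->
  let z := fine (Zps ps w) in let q := fine (Qps ps s o w) in
  let p := nth q0 qs n in
  EHps ps qs s o w \is a fin_num /\
  t * mean_optP ps p.1 p.2 s o w + fine (EHps ps qs s o w) + q <=
  q * - ln eps + q * t * (meanP ps p.1 p.2 w / z) + z * eps * (1 + 2 * t ^+ 2).
Proof.
move=> Zf nq e01 t01 z q p.
have [e0 e1] := andP e01; have [t0 t1] := andP t01.
have [Zz z0] := Zps_fin Zf; rewrite -/z in Zz z0.
have [Qq /andP[q_ge0 qz]] := Qps_fin s o Zf; rewrite -/q -/z in Qq q_ge0 qz.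
have [M0E /andP[M0_ge0 M0z]] := meanP_fin p.1 p.2 Zf; rewrite -/z in M0z.
have [M1E /andP[M1_ge0 M1q]] := mean_optP_fin p.1 p.2 s o Zf.
set m0 := meanP ps p.1 p.2 w in M0E M0_ge0 M0z *.
set m1 := mean_optP ps p.1 p.2 s o w in M1E M1_ge0 M1q *.
have [m mE] : exists m, m = m0 / z by exists (m0 / z).
have m01 : 0 <= m <= 1 by rewrite mE divr_ge0 ?(ltW z0)//= ler_pdivrMr// mul1r.
have [m_ge0 _] := andP m01.
have lne : 0 <= - ln eps by rewrite oppr_ge0 ln_le0.
pose r (v : Om) : \bar R := (`|v (inr (size ps + n)%N)|)%:E.
pose l := rwl (size ps) (size qs).
pose Q' := Qps (ps ++ qs) s o; pose Z' := Zps (ps ++ qs).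
have mn : measurable_fun setT (Num.norm : R -> R) by exact: normr_measurable.
have nr : nnmeas r.
  apply: nnmeas_EFin => [|v]; last exact: normr_ge0.
  by apply: measurableT_comp (measurable_eval _).
have nQ : nnmeas Q' by exact: nnmeas_Qps.
have nZ : nnmeas Z' by exact: nnmeas_Zps.
have nH := nnmeas_Hps (ps ++ qs) s o.
have ncst (c : R) (F : Om -> \bar R) : 0 <= c -> nnmeas F -> nnmeas (fun v : Om =>
    c%:E * F v)%E.
  by move=> c0 nF; apply: nnmeasM => //; exact: nnmeas_cst.
pose F (v : Om) : \bar R := (t%:E * (r v * Q' v) + (Hps (ps ++ qs) s o v)%:E
  + (Q' v + (eps * t * m)%:E * Z' v))%E.
pose G (v : Om) : \bar R := ((- ln eps + t * m)%:E * Q' v +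
  ((eps * (1 + 2 * t ^+ 2))%:E * Z' v + (eps * t)%:E * (r v * Z' v)))%E.
have etm : 0 <= eps * t * m by rewrite !mulr_ge0 ?(ltW e0).
have lntm : 0 <= - ln eps + t * m by rewrite addr_ge0// mulr_ge0.
have et2_gt0 : 0 < eps * (1 + 2 * t ^+ 2).
  by rewrite mulr_gt0// ltr_wpDr// mulr_ge0// sqr_ge0.
have et0 : 0 <= eps * t by rewrite mulr_ge0 ?(ltW e0).
have nF1 := ncst _ _ t0 (nnmeasM nr nQ).
have nF2 := ncst _ _ etm nZ.
have nG1 := ncst _ _ lntm nQ.
have nG2 := ncst _ _ (ltW et2_gt0) nZ.
have nG3 := ncst _ _ et0 (nnmeasM nr nZ).
have nF : nnmeas F by apply: nnmeasD; apply: nnmeasD.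
have nG : nnmeas G by apply: nnmeasD => //; apply: nnmeasD.
have FG : (ints l F w <= ints l G w)%E.
  apply: le_ints => //; [exact: wI_meas|exact: wI_ge0|exact: uniq_rwl|].
  move=> v _ wv; have rl : inr (size ps + n)%N \in l.
    by rewrite mem_rwl leq_addr ltn_add2l.
  have /b_out r01 := wv _ rl; have [r_ge0 _] := andP r01.
  (* Where the new normalising constant is infinite, [G] is infinite too, because the coefficient of
     [Z'] is positive even at [t = 0]. *)
  have [Zf'|] := ltP (Z' v) +oo%E; last first.
    rewrite leye_eq => /eqP Zoo; rewrite [leRHS](_ : _ = +oo%E) ?leey//.
    have h2 : ((eps * (1 + 2 * t ^+ 2))%:E * Z' v = +oo)%E.
      by rewrite Zoo gt0_muley ?lte_fin.
    rewrite /G h2 addye ?addey//.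
      by rewrite gt_eqF// (lt_le_trans ltNy0)// nG1.2.
    by rewrite gt_eqF// (lt_le_trans ltNy0)// nG3.2.
  have [Qv /andP[q'0 q'z]] := Qps_fin s o Zf'; have [Zv _] := Zps_fin Zf'.
  rewrite /F /G /Q' /Z' /r Qv Zv ger0_norm// -!EFinM -!EFinD lee_fin /Hps.
  have := ent_fenchel q'0 q'z r01 m01 t01 e01; lra.
have zm : z * m = m0 by rewrite mE mulrC divfK ?gt_eqF.
have IQ : ints l Q' w = q%:E.
  rewrite -Qq; apply: (@transport1 ps qs n (opt s o) w nq) => [|t'];
      [exact: measurable_opt1|exact: opt_ge0].
have IZ : ints l Z' w = z%:E.
  rewrite -Zz ZpsP -(@transport1 ps qs n (cst 1) w nq)//.
  by apply: eq_ints => v _; exact: ZpsP.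
have trn (g : instance R S K -> R) :
    measurable_fun setT (fun v : Om => g (thof v)) -> (forall x, 0 <= g x) ->
    ints l (fun v => r v * expP (ps ++ qs) (g \o thof) v)%E w =
    expP ps (fun v => g (thof v) * mean_of M (thof v p.1 p.2)) w.
  move=> mg g0; apply: (@transport ps qs n q0 Num.norm (mean_of M) g w nq mn) => //.
  by move=> x; rewrite meanE.
have IrQ : ints l (fun v => r v * Q' v)%E w = m1%:E.
  rewrite -M1E -(trn (opt s o))//; first exact: measurable_opt1.
  by move=> x; exact: opt_ge0.
have IrZ : ints l (fun v => r v * Z' v)%E w = m0%:E.
  rewrite -M0E.
  transitivity (expP ps (fun v => cst 1 (thof v) * mean_of M (thof v p.1 p.2)) w).
    by rewrite -trn//; apply: eq_ints => v _; rewrite /Z' ZpsP.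
  by apply: eq_ints => v _; rewrite mul1r.
have Wm := wI_meas; have W0 := wI_ge0.
have IF : ints l F w = ((t * m1 + q + eps * t * m * z)%:E + EHps ps qs s o w)%E.
  rewrite /F intsD//; last 2 first.
  - exact: nnmeasD.
  - exact: nnmeasD.
  rewrite (intsD mI Wm W0 _ _ nF1 nH) (intsD mI Wm W0 _ _ nQ nF2).
  rewrite !intsZ ?lee_fin//; last exact: nnmeasM.
  rewrite IQ IZ IrQ -/(EHps ps qs s o w) -!EFinM -EFinD.
  by rewrite addeAC -EFinD addrA.
have IG : ints l G w = (q * (- ln eps + t * m) + z * eps * (1 + 2 * t ^+ 2) + eps * t * m0)%:E.
  rewrite /G intsD//; last exact: nnmeasD.
  rewrite (intsD mI Wm W0 _ _ nG2 nG3) !intsZ ?lee_fin ?(ltW et2_gt0)//; last exact: nnmeasM.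
  rewrite IQ IZ IrZ -!EFinM -!EFinD; congr EFin; ring.
have EH0 : (0 <= EHps ps qs s o w)%E by apply: ints_ge0.
rewrite IF IG in FG.
(* Finiteness of the expected entropy comes from the inequality itself, whose right side is
   finite. *)
have Efin : EHps ps qs s o w \is a fin_num.
  rewrite ge0_fin_numE// ltNge leye_eq; apply/eqP => Eoo.
  by move: FG; rewrite Eoo addey// leye_eq.
split => //; move: FG; rewrite -(fineK Efin) -EFinD lee_fin /=.
have -> : eps * t * m * z = eps * t * m0 by rewrite -zm; ring.
by rewrite -mE; lra.
Qed.

Lemma size_pulls (c : {ffun 'I_N -> S}) (acts : {ffun 'I_N -> 'I_K}) :
  size (pulls c acts) = N.
Proof. by rewrite size_map size_enum_ord. Qed.

Lemma nth_pulls q0 (c : {ffun 'I_N -> S}) (acts : {ffun 'I_N -> 'I_K}) (n : 'I_N) :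
  nth q0 (pulls c acts) n = (c n, acts n).
Proof. by rewrite (nth_map n) ?size_enum_ord// nth_ord_enum. Qed.

Lemma sum_Qps ps s w : (Zps ps w < +oo)%E ->
  \sum_a fine (Qps ps s a w) = fine (Zps ps w).
Proof.
move=> Zf; apply: EFin_inj; rewrite -(Zps_fin Zf).1 -sumEFin ZpsP.
transitivity (expP ps (fun v => \sum_a opt s a (thof v)) w).
  rewrite expP_sum => [|a|a v]; [|exact: measurable_opt1|exact: opt_ge0].
  by apply: eq_bigr => a _; rewrite -(Qps_fin s a Zf).1.
by apply: eq_ints => v _; rewrite opt_sum.
Qed.

Lemma ts_probZ ps s a w : (Zps ps w < +oo)%E ->
  ts_prob M (obs 0 ps w) s a = fine (Qps ps s a w) / fine (Zps ps w).
Proof.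
move=> Zf; have [Zz z0] := Zps_fin Zf.
rewrite (ts_probP _ _ Zf) Zz -EFinM /= mulfK// gt_eqF//.
Qed.

Lemma sum_ts_prob ps s w : (Zps ps w < +oo)%E ->
  \sum_a ts_prob M (obs 0 ps w) s a = 1.
Proof.
move=> Zf; under eq_bigr do rewrite ts_probZ//.
by rewrite -mulr_suml sum_Qps// divff// gt_eqF// (Zps_fin Zf).2.
Qed.

Lemma sum_actw ps c w : (Zps ps w < +oo)%E -> \sum_acts actw ps c acts w = 1.
Proof.
move=> Zf; rewrite /actw.
rewrite -(bigA_distr_bigA (fun n a => ts_prob M (obs 0 ps w) (c n) a)).
by apply: big1 => n _; exact: sum_ts_prob.
Qed.

Lemma sum_ctxw : \sum_c ctxw c = 1.
Proof.
rewrite /ctxw -(bigA_distr_bigA (fun (n : 'I_N) s => PSw s)).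
by apply: big1 => n _.
Qed.

(** * The regret of one round against the entropy decrease *)

Definition gapP ps c acts w : R := fine (expP ps (fun v => gap c acts (thof v)) w).

(** [expP] is additive on nonnegative functions, so the identity is first proved as gap plus played
    mean equals best mean; the subtraction is made at the end between finite numbers. *)
Lemma gapPE ps c acts w : (Zps ps w < +oo)%E ->
  expP ps (fun v => gap c acts (thof v)) w = (gapP ps c acts w)%:E /\
  gapP ps c acts w = \sum_(n < N) (\sum_a mean_optP ps (c n) a (c n) a w
     - meanP ps (c n) (acts n) w).
Proof.
move=> Zf.
pose best := \sum_(n < N) \sum_a mean_optP ps (c n) a (c n) a w.
pose played := \sum_(n < N) meanP ps (c n) (acts n) w.
have playedE : expP ps (fun v => \sum_(n < N) mean_of M (thof v (c n) (acts n))) w = played%:E.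
  rewrite expP_sum => [|n|n v]; [|exact: measurable_mean1|exact: mean_ge0].
  by rewrite -sumEFin; apply: eq_bigr => n _; rewrite -(meanP_fin _ _ Zf).1.
have mo s a : measurable_fun setT (fun v : Om => opt s a (thof v) * mean_of M (thof v s a)).
  by apply: measurable_funM; [exact: measurable_opt1|exact: measurable_mean1].
have o0 s a v : 0 <= opt s a (thof v) * mean_of M (thof v s a).
  by rewrite mulr_ge0 ?opt_ge0 ?mean_ge0.
have bestE : expP ps (fun v => \sum_(n < N) mustar M (thof v) (c n)) w = best%:E.
  rewrite expP_sum => [|n|n v]; first last.
  - by rewrite mustarE// sumr_ge0// => a _; rewrite mulrC.
  - exact: measurable_mustar.
  rewrite -sumEFin; apply: eq_bigr => n _; rewrite -sumEFin.
  transitivity (expP ps (fun v => \sum_a opt (c n) a (thof v) * mean_of M (thof v (c n) a)) w).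
    apply: eq_ints => v _; rewrite mustarE//.
    by under [X in (_ * X)%:E]eq_bigr do rewrite mulrC.
  rewrite expP_sum => [|a|a v]; [|exact: mo|exact: o0].
  by apply: eq_bigr => a _; rewrite -(mean_optP_fin _ _ _ _ Zf).1.
have e : (expP ps (fun v => gap c acts (thof v)) w + played%:E = best%:E)%E.
  rewrite -playedE -bestE -expPD; first last.
  - by move=> v; apply: sumr_ge0 => n _; exact: mean_ge0.
  - by apply: measurable_sum => n; exact: measurable_mean1.
  - by move=> v; exact: gap_ge0.
  - exact: measurable_gap.
  apply: eq_ints => v _; congr (_ * _)%:E; rewrite /gap -big_split/=.
  by apply: eq_bigr => n _; rewrite subrK.
have e' : expP ps (fun v => gap c acts (thof v)) w = (best - played)%:E.
  by rewrite EFinB -e addeK.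
by rewrite /gapP e'; split => //=; rewrite /best /played -sumrB.
Qed.

Definition totH ps w : R := \sum_(p : S * 'I_K) Hps ps p.1 p.2 w.
Definition totEH ps qs w : R := \sum_(p : S * 'I_K) fine (EHps ps qs p.1 p.2 w).

(** Observing rewards does not increase an entropy term on average: [key_ineq] at [t = 0] supplies
    the hypothesis of [ent_jensen]. *)
Lemma EHps_le ps qs n s o w : (Zps ps w < +oo)%E -> (n < size qs)%N ->
  EHps ps qs s o w \is a fin_num /\ fine (EHps ps qs s o w) <= Hps ps s o w.
Proof.
move=> Zf nq; case: qs nq => // q0 qs nq.
have key eps := @key_ineq ps (q0 :: qs) n q0 s o w eps 0 Zf nq.
split.
  have := key 1; rewrite ltr01 !lexx invr_ge0 ler0n => /(_ isT isT) []//.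
have [Zz z0] := Zps_fin Zf; have [_ /andP[q_ge0 qz]] := Qps_fin s o Zf.
apply: ent_jensen => // eps e01.
have := key eps e01; rewrite lexx invr_ge0 ler0n => /(_ isT) [_].
by lra.
Qed.

(** A potential argument for one round with potential [Y * totH]: regret plus expected next
    potential is at most the present potential plus [X] per agent, scaled by the normalising
    constant. *)
Definition round_bound (X Y : R) := forall ps w (c : {ffun 'I_N -> S}),
  (Zps ps w < +oo)%E ->
  \sum_acts actw ps c acts w * (gapP ps c acts w + Y * totEH ps (pulls c acts) w) <=
  N%:R * X * fine (Zps ps w) + Y * totH ps w.

Lemma round_bound_entropy lam : (0 < N)%N -> 0 < lam ->
  round_bound (K%:R * lam) (N%:R * (2 / lam)).
Proof.
move=> N0 l0 ps w c Zf; set z := fine (Zps ps w).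
have [Zz z0] := Zps_fin Zf; rewrite -/z in Zz z0.
pose p (n : 'I_N) a := ts_prob M (obs 0 ps w) (c n) a.
have p0 n a : 0 <= p n a by exact: ts_prob_ge0.
pose D (acts : {ffun 'I_N -> 'I_K}) := totH ps w - totEH ps (pulls c acts) w.
have nq (acts : {ffun 'I_N -> 'I_K}) (n : 'I_N) : (n < size (pulls c acts))%N.
  by rewrite size_pulls.
have EHle acts s o := EHps_le s o Zf (nq acts (Ordinal N0)).
(* No entropy term increases on average, so the decrease of a single pair is at most the total
   decrease [D]; this allows the same [D] to serve every agent. *)
have HD acts s a : Hps ps s a w - fine (EHps ps (pulls c acts) s a w) <= D acts.
  rewrite /D /totH /totEH -sumrB (bigD1 (s, a))//= lerDl sumr_ge0// => -[s' a'] _.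
  by rewrite subr_ge0; have [] := EHle acts s' a'.
(* In [ent_step] the entropy decrease and the present mean both carry the factor [p n a], as
   [batch_sum] requires; the error [lam * z] is paid once per arm. *)
have one n : \sum_a mean_optP ps (c n) a (c n) a w <=
   \sum_acts actw ps c acts w * (meanP ps (c n) (acts n) w + 2 / lam * D acts)
   + K%:R * (lam * z).
  apply: (@batch_sum _ N K p n
     (fun acts => meanP ps (c n) (acts n) w + 2 / lam * D acts)).
  - exact: p0.
  - by move=> n'; exact: sum_ts_prob.
  move=> acts; set a := acts n.
  have [_ /andP[q_ge0 qz]] := Qps_fin (c n) a Zf.
  have [_ /andP[m0_ge0 _]] := meanP_fin (c n) a Zf.
  have [_ /andP[m1_ge0 m1q]] := mean_optP_fin (c n) a (c n) a Zf.
  have := @ent_step R _ z _ _ (fine (EHps ps (pulls c acts) (c n) a w)) lam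
    z0 q_ge0 qz m1_ge0 m1q m0_ge0 l0.
  move=> h; apply: le_trans (_ : mean_optP ps (c n) a (c n) a w <= _) _ => //.
  have {}h := h _; rewrite -lerBlDr.
  have pE : p n a = fine (Qps ps (c n) a w) / z by exact: ts_probZ.
  rewrite -pE in h; have pa := p0 n a.
  have k : mean_optP ps (c n) a (c n) a w +
      2 * p n a / lam * fine (EHps ps (pulls c acts) (c n) a w) <=
      2 * p n a / lam * Hps ps (c n) a w + p n a * meanP ps (c n) a w + lam * z.
    apply: h => eps t e01 t01.
    have [_] := @key_ineq ps (pulls c acts) n (c n, a) (c n) a w eps t Zf (nq acts n) e01 t01.
    by rewrite nth_pulls.
  have : p n a * (2 / lam) * (Hps ps (c n) a w - fine (EHps ps (pulls c acts) (c n) a w))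
     <= p n a * (2 / lam) * D acts.
    by rewrite ler_wpM2l ?HD// mulr_ge0// divr_ge0// ltW.
  by lra.
have sums : \sum_(n < N) \sum_a mean_optP ps (c n) a (c n) a w <=
    \sum_acts actw ps c acts w *
      (\sum_(n < N) meanP ps (c n) (acts n) w + N%:R * (2 / lam) * D acts)
    + N%:R * (K%:R * (lam * z)).
  apply: le_trans (ler_sum _ (fun n _ => one n)) _.
  rewrite big_split/= sumr_const card_ord -[_ *+ N]mulr_natl lerD2r.
  rewrite exchange_big/=; apply: ler_sum => acts _.
  rewrite -mulr_sumr ler_wpM2l ?actw_ge0// big_split/= sumr_const card_ord.
  by rewrite -[_ *+ N]mulr_natl; lra.
have acts1 := sum_actw c Zf.
have -> : \sum_acts actw ps c acts w *
    (gapP ps c acts w + N%:R * (2 / lam) * totEH ps (pulls c acts) w) =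
  \sum_(n < N) \sum_a mean_optP ps (c n) a (c n) a w + N%:R * (2 / lam) * totH ps w
  - \sum_acts actw ps c acts w *
      (\sum_(n < N) meanP ps (c n) (acts n) w + N%:R * (2 / lam) * D acts).
  rewrite -[X in X - _]mul1r -acts1 mulr_suml -sumrB; apply: eq_bigr => acts _.
  rewrite (gapPE c acts Zf).2 sumrB /D; ring.
by move: sums; lra.
Qed.

Lemma round_bound_trivial : round_bound 1 0.
Proof.
move=> ps w c Zf.
have -> : N%:R * 1 * fine (Zps ps w) + 0 * totH ps w =
    \sum_acts actw ps c acts w * (N%:R * fine (Zps ps w)).
  by rewrite -mulr_suml sum_actw// mulr1 mul0r addr0 mul1r.
apply: ler_sum => acts _; rewrite mul0r addr0 ler_wpM2l ?actw_ge0//.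
have -> : N%:R * fine (Zps ps w) = \sum_(n < N) fine (Zps ps w).
  by rewrite sumr_const card_ord mulr_natl.
rewrite (gapPE c acts Zf).2; apply: ler_sum => n _; rewrite lerBlDr.
have [_ /andP[m0_ge0 _]] := meanP_fin (c n) (acts n) Zf.
apply: ler_wpDr => //; rewrite -(sum_Qps (c n) Zf); apply: ler_sum => a _.
by have [_ /andP[]] := mean_optP_fin (c n) a (c n) a Zf.
Qed.

Lemma totH_ge0 ps w : 0 <= totH ps w.
Proof. by apply: sumr_ge0 => p _; exact: Hps_ge0. Qed.

(** Induction on the remaining rounds: the bound for the later rounds is integrated over the
    rewards, which preserves [Zps] and turns [totH] into [totEH], and [round_bound] absorbs the
    present round. As [X] is positive, an infinite [Zps] makes the right side infinite. *)
Lemma Vps_bound X Y : (0 < N)%N -> 0 < X -> 0 <= Y -> round_bound X Y ->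
  forall j ps w,
  (Vps j ps w <= (j%:R * N%:R * X)%:E * Zps ps w + (Y * totH ps w)%:E)%E.
Proof.
move=> N0 X0 Y0 rb; elim=> [|j ih] ps w.
  rewrite Vps0 !mul0r mul0e add0e lee_fin mulr_ge0 ?totH_ge0//.
have [Zf|] := ltP (Zps ps w) +oo%E; last first.
  rewrite leye_eq => /eqP ->; rewrite gt0_muley ?addye ?leey//.
  by rewrite lte_fin !mulr_gt0// ltr0n.
have [Zz z0] := Zps_fin Zf; set z := fine (Zps ps w) in Zz z0.
have nZ := nnmeas_Zps; have Wm := wI_meas; have W0 := wI_ge0.
have [C C0 hj] := regr_spec j.
have nq (c : {ffun 'I_N -> S}) (acts : {ffun 'I_N -> 'I_K}) :
  (0 < size (pulls c acts))%N by rewrite size_pulls.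
have jNX0 : 0 <= j%:R * N%:R * X by rewrite !mulr_ge0// ltW.
have next (c : {ffun 'I_N -> S}) (acts : {ffun 'I_N -> 'I_K}) :
   (ints (rwl (size ps) (size (pulls c acts))) (Vps j (ps ++ pulls c acts)) w <=
    (j%:R * N%:R * X * z + Y * totEH ps (pulls c acts) w)%:E)%E.
  set qs := pulls c acts; set l := rwl _ _.
  have nHs : nnmeas (fun v => \sum_(p : S * 'I_K) (Hps (ps ++ qs) p.1 p.2 v)%:E)%E.
    by apply: nnmeas_sum => p; exact: nnmeas_Hps.
  have nYH : nnmeas (fun v => Y%:E * \sum_(p : S * 'I_K) (Hps (ps ++ qs) p.1 p.2 v)%:E)%E.
    by apply: nnmeasM => //; apply: nnmeas_cst.
  have nXZ : nnmeas (fun v => (j%:R * N%:R * X)%:E * Zps (ps ++ qs) v)%E.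
    by apply: nnmeasM => //; apply: nnmeas_cst.
  apply: (@le_trans _ _ (ints l (fun v => (j%:R * N%:R * X)%:E * Zps (ps ++ qs) v +
     Y%:E * \sum_(p : S * 'I_K) (Hps (ps ++ qs) p.1 p.2 v)%:E)%E w)).
    apply: le_ints => //; first exact: uniq_rwl.
    - have [mr r0C _] := hj (ps ++ qs); apply: nnmeas_expP => // v.
      by have /andP[] := r0C v.
    - exact: nnmeasD.
    by move=> v _ _; rewrite sumEFin -EFinM; exact: ih.
  rewrite intsD// !intsZ ?lee_fin// ints_sum//; last by move=> p; exact: nnmeas_Hps.
  have -> : ints l (Zps (ps ++ qs)) w = z%:E.
    rewrite -Zz ZpsP -(@transport1 ps qs 0 (cst 1) w (nq c acts))//.
    by apply: eq_ints => v _; exact: ZpsP.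
  rewrite EFinD EFinM; apply: leeD2l; rewrite EFinM /totEH -sumEFin.
  rewrite le_eqVlt; apply/orP; left; apply/eqP; congr (_ * _)%E.
  by apply: eq_bigr => p _; rewrite fineK ?(EHps_le _ _ Zf (nq c acts)).1.
rewrite VpsS Zz.
apply: (@le_trans _ _ (\sum_c \sum_(acts : {ffun 'I_N -> 'I_K})
    (ctxw c * actw ps c acts w)%:E *
    (gapP ps c acts w + (j%:R * N%:R * X * z + Y * totEH ps (pulls c acts) w))%:E)%E).
  apply: lee_sum => c _; apply: lee_sum => acts _.
  apply: lee_wpmul2l; first by rewrite lee_fin mulr_ge0 ?ctxw_ge0 ?actw_ge0.
  by rewrite (gapPE c acts Zf).1 EFinD; apply: leeD2l; exact: next.
under eq_bigr => c _.
  under eq_bigr do rewrite -EFinM.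
  rewrite sumEFin; over.
rewrite sumEFin -EFinM -EFinD lee_fin.
set B := (X in _ <= X); have -> : B = \sum_c ctxw c * B.
  by rewrite -mulr_suml sum_ctxw mul1r.
rewrite {}/B; apply: ler_sum => c _.
rewrite (_ : \sum_acts _ = ctxw c * \sum_acts actw ps c acts w *
    (gapP ps c acts w + (j%:R * N%:R * X * z + Y * totEH ps (pulls c acts) w))); last first.
  by rewrite mulr_sumr; apply: eq_bigr => acts _; rewrite mulrA.
rewrite ler_wpM2l ?ctxw_ge0//.
have -> : \sum_acts actw ps c acts w *
    (gapP ps c acts w + (j%:R * N%:R * X * z + Y * totEH ps (pulls c acts) w)) =
  \sum_acts actw ps c acts w * (gapP ps c acts w + Y * totEH ps (pulls c acts) w)
  + j%:R * N%:R * X * z.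
  set B := (X in _ = _ + X); have -> : B = \sum_acts actw ps c acts w * B.
    by rewrite -mulr_suml sum_actw// mul1r.
  by rewrite -big_split/=; apply: eq_bigr => acts _; rewrite /B; ring.
have := rb ps w c Zf; rewrite -/z -[j.+1%:R]natr1; lra.
Qed.

(** * The regret from the empty history *)

Lemma Zps_nil w : Zps [::] w = 1%E.
Proof.
rewrite ZpsE big1// => p _; rewrite /zof.
under eq_integral do rewrite /lik big_nil.
by rewrite integral_cst//= mul1e probability_setT.
Qed.

Lemma totH_nil w : totH [::] w <= #|S|%:R * ln K%:R.
Proof.
have Z1 := Zps_nil w; have Zf : (Zps [::] w < +oo)%E by rewrite Z1 ltry.
rewrite /totH -(pair_bigA _ (fun s a => Hps [::] s a w))/=.
rewrite mulr_natl -sumr_const; apply: ler_sum => s _.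
rewrite /Hps Z1; apply: ent_max => // [a|]; first by have [_ /andP[]] := Qps_fin s a Zf.
by rewrite sum_Qps// Z1.
Qed.

Lemma BR_Vps J : (BR M N J)%:E = Vps J [::] (fun=> 0).
Proof.
have [C C0 hJ] := regr_spec J; have [mr r0C _] := hJ [::].
have [] := @prior_intP (enum [set: S * 'I_K]) (fun=> 0)
  (fun th => ts_regret M N th J [::]) (regr J [::]) C mr r0C.
  by move=> v _.
rewrite -/params => e _; rewrite /BR.
rewrite -[RHS](_ : ints params (EFin \o regr J [::]) (fun=> 0) = _)//.
by apply: eq_ints => v _; rewrite /= /Lik big_nil mul1r.
Qed.

Lemma BR_bound X Y J : (0 < N)%N -> 0 < X -> 0 <= Y -> round_bound X Y ->
  BR M N J <= J%:R * N%:R * X + Y * (#|S|%:R * ln K%:R).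
Proof.
move=> N0 X0 Y0 rb; rewrite -lee_fin BR_Vps.
apply: le_trans (Vps_bound N0 X0 Y0 rb J [::] (fun=> 0)) _.
by rewrite Zps_nil mule1 -EFinD lee_fin lerD2l ler_wpM2l// totH_nil.
Qed.

Lemma BR_entropy lam J : (0 < N)%N -> 0 < lam ->
  BR M N J <= J%:R * N%:R * (K%:R * lam) + N%:R * (2 / lam) * (#|S|%:R * ln K%:R).
Proof.
move=> N0 l0; apply: BR_bound => //; last exact: round_bound_entropy.
  by rewrite mulr_gt0// ltr0n.
by rewrite mulr_ge0// divr_ge0// ltW.
Qed.

Lemma BR_trivial J : (0 < N)%N -> BR M N J <= J%:R * N%:R.
Proof.
move=> N0; have := BR_bound J N0 ltr01 (lexx 0) round_bound_trivial.
by rewrite mul0r addr0 mulr1.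
Qed.

End RegularModel.

(** * Reduction to a regular model *)

Section RawIntegrals.
Local Open Scope ereal_scope.
Context d (X : measurableType d) (R : realType).
Import HBNNSimple.

(* Measurability of [f] and [g] cannot be assumed: outside [Theta] the integrands
   against the prior are arbitrary functions. *)
Lemma le_ge0_integral_ae (mu : {measure set X -> \bar R}) (D : set X)
    (f g : X -> \bar R) : measurable D -> mu (~` D) = 0 ->
  (forall x, 0 <= f x) -> (forall x, 0 <= g x) -> (forall x, D x -> f x = g x) ->
  \int[mu]_x f x <= \int[mu]_x g x.
Proof.
move=> mD D0 f0 g0 fg; rewrite !ge0_integralTE//.
apply: ge_ereal_sup => _ [h /= hf <-].
(* Cutting the simple function [h] down to [D] puts it below [g] everywhere and keeps its integral,
   since the complement of [D] is null. *)
apply: ereal_sup_ubound => /=; exists (proj_nnsfun h mD) => [x|].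
  rewrite /= mindicE; have [xD|xD] := boolP (x \in D).
    by rewrite mulr1 -fg; [exact: hf|exact/set_mem].
  by rewrite mulr0.
rewrite -!integralT_nnsfun; apply: ae_eq_integral => //.
- by apply/measurable_EFinP.
- by apply/measurable_EFinP.
exists (~` D); split => //; first exact: measurableC.
move=> x /= nh Dx; apply: nh => _; rewrite /= mindicE mem_set//.
by rewrite mulr1.
Qed.

Lemma eq_integral_ae (mu : {measure set X -> \bar R}) (D : set X)
    (f g : X -> \bar R) : measurable D -> mu (~` D) = 0 ->
  (forall x, D x -> f x = g x) -> \int[mu]_x f x = \int[mu]_x g x.
Proof.
move=> mD D0 fg; rewrite integralE [RHS]integralE.
by congr (_ - _); apply/le_anti/andP; split; apply: (le_ge0_integral_ae mD D0) => // x Dx;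
  rewrite ?funeposE ?funenegE fg.
Qed.

(** The integrand may be non-measurable, so the proof compares simple functions: one lying below a
    nonnegative function that vanishes off [D] has its nonzero level sets inside [D], where both
    measures agree. *)
Lemma eq_integral_supp (mu nu : {measure set X -> \bar R}) (D : set X)
    (f : X -> \bar R) : (forall A, measurable A -> nu A = mu (A `&` D)) ->
  (forall x, ~ D x -> f x = 0) -> \int[mu]_x f x = \int[nu]_x f x.
Proof.
move=> nuE.
suff ge0 g : (forall x, 0 <= g x) -> (forall x, ~ D x -> g x = 0) ->
    \int[mu]_x g x = \int[nu]_x g x.
  move=> f0; rewrite integralE [RHS]integralE; congr (_ - _).
    by apply: ge0 => // x Dx; rewrite funeposE f0// maxxx.
  by apply: ge0 => // x Dx; rewrite funenegE f0// oppe0 maxxx.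
move=> g0 gD; rewrite !ge0_integralTE//; congr ereal_sup.
apply: eq_imagel => h /= hg; apply: eq_fsbigr => x _.
have [->|x0] := eqVneq x 0%R; first by rewrite !mul0e.
rewrite nuE//; congr (_ * mu _); apply/seteqP; split => [y /= hy|y []//].
split => //; apply: contrapT => /gD gy.
have := hg y; rewrite gy lee_fin hy => xle0.
by move/negP: x0; apply; rewrite eq_le xle0 -hy fun_ge0.
Qed.

End RawIntegrals.

(** The histories on which the likelihoods of the two models below agree; [Tf] is altered outside
    [[0, 1]]. *)
Definition good (R : realType) (S : finType) (K : nat) (h : history R S K) :=
  all (fun o => 0 <= o.2 <= 1) h.

(** * Invariance of the regret under a change of model *)

Section ChangeOfModel.
Variables (R : realType) (S : finType) (K N : nat) (M M' : ts_model R S K).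
Variable pat : R -> R.
Hypothesis Theta_meas : measurable (Theta M).
Hypothesis prior_Theta : forall s a, prior M s a (~` Theta M) = 0%E.
Hypothesis pat_id : forall x, Theta M x -> pat x = x.
Hypothesis PSE : PS M' = PS M.
Hypothesis priorE : prior M' = prior M.
Hypothesis reward_integral : forall x (g : R -> R),
  (\int[nu M']_(r in `[0%R, 1%R]) (dens M' x r * g r)%:E =
   \int[nu M]_(r in `[0%R, 1%R]) (dens M (pat x) r * g r)%:E)%E.
Hypothesis lik_change : forall h s a x, good h ->
  lik M' h s a x = lik M h s a (pat x).

Lemma mean_change x : mean_of M' x = mean_of M (pat x).
Proof.
rewrite /mean_of; congr fine.
under eq_integral do rewrite mulrC; under [RHS]eq_integral do rewrite mulrC.
exact: reward_integral.
Qed.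

Lemma lik_changeT h s a x : good h -> Theta M x -> lik M' h s a x = lik M h s a x.
Proof. by move=> hg xT; rewrite lik_change// pat_id. Qed.

Lemma post_norm_change h s a : good h -> post_norm M' h s a = post_norm M h s a.
Proof.
move=> hg; rewrite /post_norm priorE; congr fine.
by apply: (eq_integral_ae Theta_meas (prior_Theta s a)) => x xT; rewrite lik_changeT.
Qed.

Lemma post_change h s a (B B' : set R) : good h ->
  (forall y, Theta M y -> B' y <-> B y) -> post M' h s a B' = post M h s a B.
Proof.
move=> hg BB; rewrite /post post_norm_change//; rewrite priorE; congr (fine _ / _).
rewrite integral_mkcond [RHS]integral_mkcond.
apply: (eq_integral_ae Theta_meas (prior_Theta s a)) => x xT.
rewrite !patchE lik_changeT//.
have -> // : (x \in B') = (x \in B).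
by apply/idP/idP; rewrite !inE => /BB; exact.
Qed.

Lemma ts_prob_change h s a : good h -> ts_prob M' h s a = ts_prob M h s a.
Proof.
move=> hg; rewrite /ts_prob post_norm_change//; rewrite priorE; congr (fine _ / _).
apply: (eq_integral_ae Theta_meas (prior_Theta s a)) => x xT.
rewrite lik_changeT//; congr (_ * _)%:E; apply: eq_bigr => a' _.
apply: post_change => // y yT /=.
by rewrite !mean_change !pat_id.
Qed.

Definition pati (th : instance R S K) : instance R S K := fun s a => pat (th s a).

Lemma mustar_change th s : mustar M' th s = mustar M (pati th) s.
Proof. by apply: eq_bigr => a _; rewrite mean_change. Qed.

Lemma rw_int_change th ps (G G' : seq R -> R) :
  (forall rs, all (fun r => 0 <= r <= 1) rs -> G' rs = G rs) ->
  rw_int M' th ps G' = rw_int M (pati th) ps G.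
Proof.
elim: ps G G' => [|p ps ih] G G' hG; first exact: hG.
rewrite [LHS]/= reward_integral /=; congr fine.
apply: eq_integral => r; rewrite inE/= in_itv/= => r01; congr (_ * _)%:E.
by apply: ih => rs hrs; apply: hG; rewrite /= r01.
Qed.

Lemma ts_regret_change th j h : good h ->
  ts_regret M' N th j h = ts_regret M N (pati th) j h.
Proof.
elim: j h => // j ih h hg /=.
rewrite PSE; apply: eq_bigr => c _; congr (_ * _); apply: eq_bigr => acts _;
    congr (_ * (_ + _)).
- by apply: eq_bigr => n _; rewrite ts_prob_change.
- by apply: eq_bigr => n _; rewrite mustar_change mean_change.
apply: rw_int_change => rs hrs; apply: ih.
rewrite /good all_cat; apply/andP; split => //.
elim: (pulls c acts) rs hrs => [|q qs ihq] [|r rs]//= /andP[-> /ihq].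
exact.
Qed.

(** Parameters outside [l] are already drawn and lie in [Theta], up to a null set at each
    integration; once [l] is exhausted, [pat] therefore fixes the whole instance. *)
Lemma prior_int_change (l : seq (S * 'I_K)) (F F' : instance R S K -> R) th :
  (forall t, F' t = F (pati t)) ->
  (forall p : S * 'I_K, p \notin l -> Theta M (th p.1 p.2)) ->
  prior_int M l F th = prior_int M' l F' th.
Proof.
move=> hF; elim: l th => [|p l ih] th hth /=.
  rewrite hF; congr F; apply/funext => s; apply/funext => a.
  by rewrite /pati pat_id//; exact: (hth (s, a)).
rewrite priorE; congr fine; apply: (eq_integral_ae Theta_meas (prior_Theta _ _)) => x xT.
congr EFin; apply: ih => q ql; rewrite /upd -xpair_eqE -!surjective_pairing.
by case: eqP => // /eqP qp; apply: hth; rewrite inE negb_or qp.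
Qed.

Lemma BR_change J : BR M N J = BR M' N J.
Proof.
apply: prior_int_change => [t|p]; first exact: ts_regret_change.
by rewrite mem_enum in_setT.
Qed.

End ChangeOfModel.

(** * Construction of the regular model *)

Section RegularVersion.
Variables (R : realType) (S : finType) (K : nat) (M : ts_model R S K).
Hypothesis Theta_meas : measurable (Theta M).
Hypothesis b_meas : measurable_fun (`[0%R, 1%R] : set R) (bf M).
Hypothesis T_meas : measurable_fun (`[0%R, 1%R] : set R) (Tf M).
Hypothesis eta_meas : measurable_fun (Theta M) (etaf M).
Hypothesis A_meas : measurable_fun (Theta M) (Af M).
Hypothesis b_ge0 : forall r, 0 <= r <= 1 -> 0 <= bf M r.
Hypothesis dens_prob : forall th, Theta M th ->
  (\int[nu M]_(r in `[0%R, 1%R]) (dens M th r)%:E)%E = 1%E.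
Hypothesis prior_Theta : forall s a, prior M s a (~` Theta M) = 0%E.
Variable x0 : R.
Hypothesis x0Theta : Theta M x0.

(** Parameters outside [Theta] are sent to [x0], so that every real parameter has a normalised
    density. *)
Definition pat (x : R) : R := if x \in Theta M then x else x0.

Definition extend (D : set R) (f : R -> R) (c : R) : R -> R :=
  fun x => if x \in D then f x else c.

Lemma measurable_extend (D : set R) (f : R -> R) (c : R) :
  measurable D -> measurable_fun D f -> measurable_fun setT (extend D f c).
Proof.
move=> mD mf; have -> : extend D f c = ((fun x => f x - c) \_ D) \+ cst c.
  apply/funext => x; rewrite /extend /= patchE; case: ifP => _; first by rewrite subrK.
  by rewrite add0r.
apply: measurable_funD => //; apply/(measurable_restrictT _ mD).
exact: measurable_funB.
Qed.

Lemma extend_pat (f : R -> R) x : extend (Theta M) f (f x0) x = f (pat x).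
Proof. by rewrite /extend /pat; case: ifP. Qed.

Lemma patT x : Theta M (pat x).
Proof. by rewrite /pat; case: ifPn => // /set_mem. Qed.

Lemma pat_id x : Theta M x -> pat x = x.
Proof. by move=> xT; rewrite /pat mem_set. Qed.

Notation I01 := (`[0%R, 1%R]%classic : set R).

Lemma in_I01 r : (r \in I01) = (0 <= r <= 1).
Proof. by apply/idP/idP; rewrite inE/= in_itv. Qed.

Definition supp : set R := I01 `&` [set r | 0 < bf M r].

Lemma measurable_supp : measurable supp.
Proof.
have -> : supp = I01 `&` (bf M) @^-1` `]0%R, +oo[%classic.
  by congr (_ `&` _); apply/seteqP; split => r /=; rewrite in_itv/= andbT.
by apply: b_meas => //; exact: measurable_itv.
Qed.

(* [nu M] itself need not be sigma-finite; its restriction to [supp] is, because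
   the density at [x0] is integrable and positive there. *)
Definition nu_supp : set R -> \bar R := mrestr (nu M) measurable_supp.
HB.instance Definition _ := Measure.copy nu_supp (mrestr (nu M) measurable_supp).

Lemma measurable_dens0 : measurable_fun I01 (dens M x0).
Proof.
apply: measurable_funM => //; apply: measurableT_comp; first exact: measurable_expR.
apply: measurable_funB => //; exact: measurable_funM.
Qed.

Lemma dens_ge0 x r : 0 <= r <= 1 -> 0 <= dens M x r.
Proof. by move=> r01; rewrite mulr_ge0 ?b_ge0 ?expR_ge0. Qed.

(** Markov's inequality: the set where the density at [x0] is at least [n.+1%:R^-1] has measure at
    most [n.+1]. These sets cover [supp], and its complement is null for [nu_supp]. *)
Lemma sigma_finite_nu_supp : sigma_finite setT nu_supp.
Proof.
pose B n := I01 `&` [set r | n.+1%:R^-1 <= dens M x0 r].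
have mB n : measurable (B n).
  have -> : B n = I01 `&` (dens M x0) @^-1` `[n.+1%:R^-1, +oo[%classic.
    by congr (_ `&` _); apply/seteqP; split => r /=; rewrite in_itv/= andbT.
  by apply: measurable_dens0 => //; exact: measurable_itv.
exists (fun n => ~` supp `|` B n); last first.
  move=> n; split; first by apply: measurableU => //; apply: measurableC;
      exact: measurable_supp.
  apply: (@le_lt_trans _ _ (nu M (B n))).
    rewrite /nu_supp /mrestr; apply: le_measure; rewrite ?inE//.
      apply: measurableI; last exact: measurable_supp.
      by apply: measurableU => //; apply: measurableC; exact: measurable_supp.
    by move=> r [[]].
  have : (n.+1%:R^-1%:E * nu M (B n) <= 1)%E.
    rewrite -(dens_prob x0Theta) -integral_cst//.
    apply: (@le_trans _ _ (\int[nu M]_(r in B n) (dens M x0 r)%:E)%E).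
      apply: ge0_le_integral => //.
      - by move=> r _; rewrite lee_fin invr_ge0 ler0n.
      - apply/measurable_EFinP; apply: measurable_funS measurable_dens0 => //.
        by move=> r [].
      - by move=> r []; rewrite lee_fin.
    apply: ge0_subset_integral => //.
    - by apply/measurable_EFinP; exact: measurable_dens0.
    - by move=> r /=; rewrite in_itv/= => r01; rewrite lee_fin dens_ge0.
    by move=> r [].
  apply: contraTT; rewrite -leNgt leye_eq => /eqP ->.
  by rewrite gt0_muley ?lte_fin ?invr_gt0// -ltNge ltry.
apply/seteqP; split => // r _ /=.
have [rs|rs] := pselect (supp r); last by exists 0%N => //; left.
have [rI b0] := rs; have d0 : 0 < dens M x0 r by rewrite mulr_gt0 ?expR_gt0.
exists (Num.truncn (dens M x0 r)^-1) => //; right; split => //=.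
rewrite -[leRHS]invrK lef_pV2 ?posrE ?invr_gt0// ltW//.
exact: truncnS_gt.
Qed.

HB.instance Definition _ :=
  Measure_isSigmaFinite.Build _ _ _ nu_supp sigma_finite_nu_supp.

Definition regular_version : ts_model R S K :=
  regmodel (PS M) (nu_supp : {sigma_finite_measure set R -> \bar R})
   (extend I01 (bf M) 0) (extend I01 (Tf M) 0)
   (extend (Theta M) (etaf M) (etaf M x0)) (extend (Theta M) (Af M) (Af M x0))
   (Theta M) (prior M).
Notation M' := regular_version.

Lemma dens_regular x r : 0 <= r <= 1 -> dens M' x r = dens M (pat x) r.
Proof. by move=> r01; rewrite /dens /= !extend_pat /extend !in_I01 r01. Qed.

(** On [[0, 1]] outside [supp] the density is 0, so restricting the measure changes nothing. [g] is
    arbitrary because it stands for the nested integrals of [rw_int]. *)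
Lemma reward_integral x (g : R -> R) :
  (\int[nu M']_(r in I01) (dens M' x r * g r)%:E =
   \int[nu M]_(r in I01) (dens M (pat x) r * g r)%:E)%E.
Proof.
transitivity (\int[nu M']_(r in I01) (dens M (pat x) r * g r)%:E)%E.
  by apply: eq_integral => r; rewrite in_I01 => r01; rewrite dens_regular.
rewrite integral_mkcond [RHS]integral_mkcond; apply/esym.
apply: (eq_integral_supp (D := supp)) => // r nr; rewrite patchE.
case: ifPn => // rI; rewrite /dens.
have [rI' r01] : I01 r /\ 0 <= r <= 1 by split; [exact/set_mem|rewrite -in_I01].
suff -> : bf M r = 0 by rewrite !mul0r.
apply/le_anti; rewrite b_ge0// andbT leNgt; apply/negP => b0; exact: nr.
Qed.

Lemma lik_regular h s a x : good h -> lik M' h s a x = lik M h s a (pat x).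
Proof.
move=> /allP hg; rewrite /lik big_seq_cond [RHS]big_seq_cond.
apply: eq_bigr => o /andP[/hg o01 _].
by rewrite /= !extend_pat /extend in_I01 o01.
Qed.

Variable N : nat.

Lemma BR_regular J : BR M N J = BR M' N J.
Proof.
exact: (@BR_change R S K N M M' pat Theta_meas prior_Theta pat_id erefl erefl
  reward_integral lik_regular).
Qed.

Hypotheses (K_gt0 : (0 < K)%N) (N_gt0 : (0 < N)%N).
Hypothesis PS_pos : forall s, 0 < PS M s.
Hypothesis PS_sum : \sum_s PS M s = 1.

Lemma regular_hyps :
  [/\ measurable_fun setT (extend I01 (bf M) 0) /\
      measurable_fun setT (extend I01 (Tf M) 0),
   measurable_fun setT (extend (Theta M) (etaf M) (etaf M x0)) /\
      measurable_fun setT (extend (Theta M) (Af M) (Af M x0)),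
   (forall r, 0 <= extend I01 (bf M) 0 r),
   (forall r, extend I01 (bf M) 0 r != 0 -> 0 <= r <= 1) &
   (forall x, (\int[nu_supp]_r (extend I01 (bf M) 0 r *
      ell (extend I01 (Tf M) 0) (extend (Theta M) (etaf M) (etaf M x0))
        (extend (Theta M) (Af M) (Af M x0)) x r)%:E = 1)%E)].
Proof.
split.
- by split; apply: measurable_extend.
- by split; apply: measurable_extend.
- by move=> r; rewrite /extend; case: ifPn; rewrite ?in_I01// => /b_ge0.
- by move=> r; rewrite /extend; case: ifPn; rewrite ?in_I01// eqxx.
move=> x; rewrite -(dens_prob (patT x)).
have := reward_integral x (cst 1).
under eq_integral do rewrite mulr1; under [X in _ = X]eq_integral do rewrite mulr1.
move=> <-; rewrite [RHS]integral_mkcond; apply: eq_integral => r _.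
rewrite patchE; case: ifPn => // rI.
by rewrite /extend (negPf rI) mul0r.
Qed.

Lemma BR_le_entropy lam J : 0 < lam ->
  BR M N J <= J%:R * N%:R * (K%:R * lam) + N%:R * (2 / lam) * (#|S|%:R * ln K%:R).
Proof.
move=> l0; have [[h1 h2] [h3 h4] h5 h6 h7] := regular_hyps.
rewrite BR_regular.
exact: (BR_entropy (Theta M) (prior M) h1 h2 h3 h4 h5 h6 h7 K_gt0 (fun s =>
    ltW (PS_pos s)) PS_sum J N_gt0 l0).
Qed.

Lemma BR_le_trivial J : BR M N J <= J%:R * N%:R.
Proof.
have [[h1 h2] [h3 h4] h5 h6 h7] := regular_hyps.
rewrite BR_regular.
exact: (BR_trivial (Theta M) (prior M) h1 h2 h3 h4 h5 h6 h7 K_gt0 (fun s =>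
    ltW (PS_pos s)) PS_sum J N_gt0).
Qed.

End RegularVersion.

(** * Choice of [lam] and the two regret bounds *)

Unset Implicit Arguments. Set Strict Implicit.

(** With this [lam] the first term equals [sq] and the second is at most [2 * sq]. *)
Lemma balanced_regret (R : realType) (B lam sq TK NS lnK : R) : 0 < lam -> 0 < sq ->
  TK * lam = sq -> NS * lnK * TK <= sq ^+ 2 -> 0 < TK ->
  B <= TK * lam + 2 / lam * (NS * lnK) -> B <= 4 * sq.
Proof.
move=> l0 s0 e h TK0 /le_trans; apply.
have -> : lam = sq / TK by rewrite -e mulrC mulKf// gt_eqF.
rewrite mulrC divfK ?gt_eqF//.
have -> : 2 / (sq / TK) * (NS * lnK) = 2 * (NS * lnK * TK) / sq.
  by field; rewrite !gt_eqF.
have : 2 * (NS * lnK * TK) / sq <= 2 * sq.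
  by rewrite ler_pdivrMr// -[leRHS]mulrA ler_wpM2l// -expr2.
by lra.
Qed.

Theorem theorem1 (R : realType) (S : finType) (K N : nat)
    (M : ts_model R S K)
    (K_gt0 : (0 < K)%N) (N_gt0 : (0 < N)%N)
    (PS_pos : forall s, 0 < PS M s)
    (PS_sum : \sum_(s : S) PS M s = 1)
    (Theta_meas : measurable (Theta M))
    (b_meas : measurable_fun (`[0%R, 1%R] : set R) (bf M))
    (T_meas : measurable_fun (`[0%R, 1%R] : set R) (Tf M))
    (eta_meas : measurable_fun (Theta M) (etaf M))
    (A_meas : measurable_fun (Theta M) (Af M))
    (b_ge0 : forall r, 0 <= r <= 1 -> 0 <= bf M r)
    (dens_prob : forall th, Theta M th ->
        (\int[nu M]_(r in `[0%R, 1%R]) (dens M th r)%:E)%E = 1%E)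
    (A_twice : forall th, Theta M th ->
        derivable (Af M) th 1 /\ derivable (derive1 (Af M)) th 1)
    (prior_Theta : forall s a, prior M s a (~` Theta M) = 0%E) :
  (forall J : nat, (0 < J)%N ->
     BR M N J <=
       2 * (#|S| * K * N)%:R
       + 4 * Num.sqrt ((2 + 6 * ln (J * N)%:R) * (#|S| * K * N * (J * N))%:R))
  /\
  (exists C : R, exists J0 : nat, forall J : nat, (J0 <= J)%N ->
     BR M N J <= C * Num.sqrt ((K * #|S| * (J * N))%:R * ln (J * N)%:R)).
Proof.
have S_gt0 : (0 < #|S|)%N.
  rewrite lt0n; apply/negP => /eqP S0; move: PS_sum.
  by rewrite big1 => [/eqP|s]; rewrite ?(eq_sym 0) ?oner_eq0//; have := fintype0 s S0.
(* If [Theta] were empty, a prior would give mass 0 to the whole line. *)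
have [x0 x0T] : exists x, Theta M x.
  have [s _] : exists s : S, s \in S by apply/card_gt0P.
  apply: contrapT => nT; have := prior_Theta s (Ordinal K_gt0).
  have -> : ~` Theta M = setT by apply/seteqP; split => // x _ xT; apply: nT; exists x.
  by rewrite probability_setT => -[] /eqP; rewrite oner_eq0.
have finite_time J : (0 < J)%N -> BR M N J <= 2 * (#|S| * K * N)%:R
   + 4 * Num.sqrt ((2 + 6 * ln (J * N)%:R) * (#|S| * K * N * (J * N))%:R).
  move=> J0; have [T TE] : exists T, T = (J * N)%N by exists (J * N)%N.
  have T0 : (0 < T)%N by rewrite TE muln_gt0 J0.
  rewrite -TE.
  have T1 : 1 <= T%:R :> R by rewrite ler1n.
  have lnT0 : 0 <= ln T%:R :> R by exact: ln_ge0.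
  pose X : R := (2 + 6 * ln T%:R) * (#|S| * K * N * T)%:R.
  have c0 : 0 < (#|S| * K * N * T)%:R :> R by rewrite ltr0n !muln_gt0 S_gt0 K_gt0 N_gt0.
  have X0 : 0 < X by rewrite mulr_gt0//; lra.
  have sX0 : 0 < Num.sqrt X by rewrite sqrtr_gt0.
  apply: (@le_trans _ _ (4 * Num.sqrt X)); last by rewrite lerDr mulr_ge0.
  (* The case [K <= T] is where [ln K] is at most [ln T], hence at most [2 + 6 * ln T]. *)
  have [KT|TK] := leqP K T.
    have TK0 : 0 < (T * K)%:R :> R by rewrite ltr0n muln_gt0 T0.
    pose lam := Num.sqrt X / (T * K)%:R.
    have l0 : 0 < lam by rewrite divr_gt0.
    have := BR_le_entropy Theta_meas b_meas T_meas eta_meas A_meas b_ge0 dens_prob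
      prior_Theta x0T K_gt0 N_gt0 PS_pos PS_sum J l0.
    move=> h; apply: (@balanced_regret _ _ lam _ (T * K)%:R (N * #|S|)%:R (ln K%:R)) => //.
    - by rewrite /lam mulrC divfK ?gt_eqF.
    - rewrite sqr_sqrtr ?(ltW X0)// /X !natrM.
      have lnKT : ln K%:R <= ln T%:R :> R by rewrite ler_ln ?posrE ?ltr0n// ler_nat.
      have -> : N%:R * #|S|%:R * ln K%:R * (T%:R * K%:R) =
        ln K%:R * (#|S|%:R * K%:R * N%:R * T%:R) :> R by ring.
      by rewrite ler_wpM2r -?natrM//; lra.
    - apply: le_trans h _; rewrite TE !natrM le_eqVlt; apply/orP; left; apply/eqP; ring.
  have := BR_le_trivial Theta_meas b_meas T_meas eta_meas A_meas b_ge0 dens_prob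
      prior_Theta x0T K_gt0 N_gt0 PS_pos PS_sum J.
  rewrite -natrM -TE => /le_trans; apply.
  (* Here [T < K], so [T ^ 2 <= K * T], which [X] dominates. *)
  apply: (@le_trans _ _ (Num.sqrt X)); last by lra.
  rewrite -[leLHS](@ger0_norm R)// -sqrtr_sqr ler_sqrt ?(ltW X0)//.
  apply: (@le_trans _ _ (1 * (#|S| * K * N * T)%:R)).
    rewrite mul1r -natrX ler_nat expnS expn1 leq_mul2r; apply/orP; right.
    rewrite -mulnA mulnCA (leq_trans (ltnW TK))// leq_pmulr// muln_gt0 S_gt0//.
  by rewrite ler_wpM2r ?(ltW c0)//; lra.
split => //.
have ln2 : 0 < ln 2 :> R by rewrite ln_gt0// ltr1n.
(* For [T >= 2] one has [2 <= 2 / ln 2 * ln T], whence [2 + 6 * ln T <= D * ln T]. *)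
pose D : R := 2 / ln 2 + 6.
(* The first summand absorbs the term free of [T], since the square root in the bound is at least
   [Num.sqrt (ln 2)]; the second takes in the factor [N]. Starting at [J = 2] ensures [T >= 2]. *)
exists (2 * (#|S| * K * N)%:R / Num.sqrt (ln 2) + 4 * Num.sqrt (D * N%:R)), 2%N => J J2.
have J0 : (0 < J)%N by exact: leq_trans J2.
apply: le_trans (finite_time J J0) _.
have [T TE] : exists T, T = (J * N)%N by exists (J * N)%N.
rewrite -TE; have T2 : (2 <= T)%N by rewrite TE (leq_trans J2)// leq_pmulr.
have T0 : (0 < T)%N by exact: leq_trans T2.
have lnT : ln 2 <= ln T%:R :> R.
  by rewrite ler_ln ?posrE ?ltr0n// ler_nat.
have c1 : 1 <= (K * #|S| * T)%:R :> R.
  by rewrite ler1n !muln_gt0 K_gt0 S_gt0.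
set Y := (K * #|S| * T)%:R * ln T%:R.
have Yln : ln 2 <= Y by rewrite -[leLHS]mul1r ler_pM// ltW.
have Y0 : 0 <= Y by rewrite (le_trans (ltW ln2)).
have D0 : 0 < D by rewrite addr_gt0// divr_gt0.
have DN0 : 0 <= D * N%:R by rewrite mulr_ge0 ?(ltW D0).
have sY : 1 <= (Num.sqrt (ln 2))^-1 * Num.sqrt Y.
  by rewrite mulrC ler_pdivlMr ?sqrtr_gt0// mul1r ler_sqrt.
rewrite [leRHS]mulrDl; apply: lerD; first by rewrite -[leRHS]mulrA ler_peMr.
rewrite -[leRHS]mulrA ler_wpM2l// -sqrtrM// ler_sqrt; last exact: mulr_ge0.
have -> : (#|S| * K * N * T)%:R = N%:R * (K * #|S| * T)%:R :> R.
  by rewrite !natrM; ring.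
have -> : D * N%:R * Y = D * ln T%:R * (N%:R * (K * #|S| * T)%:R) by rewrite /Y; ring.
have k : 2 <= 2 / ln 2 * ln T%:R :> R.
  by rewrite -mulrA ler_peMr// mulrC ler_pdivlMr// mul1r.
by rewrite ler_wpM2r// /D mulrDl; lra.
Qed.
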